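(* Let $(T,M)$ be a complete local ring, and let $G \subseteq \operatorname{Spec} T$ be a nonempty set such that the number of maximal elements of $G$ (with respect to inclusion) is finite. Then there exists a local domain $A$ such that $\hat A = T$ and the generic formal fiber of $A$ is exactly $G$ if and only if either $T$ is a field and $G = \{(0)\}$, or the following three conditions all hold: (1) $M \notin G$, and $G$ contains all the associated primes of $T$; (2) if $Q \in G$ and $P \in \operatorname{Spec} T$ with $P \subseteq Q$, then $P \in G$; (3) if $Q \in G$, then the intersection of $Q$ with the prime subring of $T$ is $(0)$.
   Context: All rings are commutative with unity. ''Local'' means Noetherian with exactly one maximal ideal; $(T,M)$ denotes a local ring $T$ with maximal ideal $M$; ''complete'' means complete with respect to the $M$-adic topology. The prime subring of $T$ is the image of $\mathbb{Z}\to T$. For a local ring $A$, $\hat A$ denotes its completion at its maximal ideal; $\hat A = T$ means that $T$ is identified with the completion of $A$ (so $A$ is a subring of $T$ with maximal ideal $M\cap A$ and the natural map $\hat A \to T$ is an isomorphism). For a local integral domain $A$ with quotient field $K$, the generic formal fiber of $A$ is $\operatorname{Spec}(\hat A\otimes_A K)$, identified with the set $\{Q \in \operatorname{Spec}\hat A : Q \cap A = (0)\}$. ''The generic formal fiber of $A$ is exactly $G$'' means $\{Q\in\operatorname{Spec} T : Q\cap A=(0)\}=G$. *)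

(* Defs.v *)
From HB Require Import structures.
From mathcomp Require Import all_boot all_order all_algebra.
From mathcomp Require Import boolp classical_sets functions cardinality.

Set Implicit Arguments.
Unset Strict Implicit.
Unset Printing Implicit Defensive.

Import GRing.Theory.

Local Open Scope classical_set_scope.
Local Open Scope ring_scope.

(* Ideals are classical sets [I : set R]; [in_set I] is the boolean predicate
   under which the closure predicates of ssralg and ring_quotient apply. *)

Section Ideals.
Variable R : comNzRingType.
Implicit Types (I J P : set R) (G : set (set R)).

Definition ideal : set (set R) :=
  [set I | @submod_closed R R^o (in_set I)].

(* [idealr_closed] includes 1 \notin P. *)
Definition prime_ideal : set (set R) :=
  [set P | idealr_closed (in_set P) /\ prime_idealr_closed (in_set P)].

Definition maximal_elements G : set (set R) :=
  [set P | G P /\ forall Q, G Q -> P `<=` Q -> Q = P].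

Definition maximal_ideal : set (set R) :=
  maximal_elements [set I | ideal I /\ I <> setT].

Definition ideal_span (S : set R) : set R := smallest ideal S.

Definition noetherian_ring : Prop :=
  forall I, ideal I -> exists s : seq R, I = ideal_span [set` s].

Definition local_ring (M : set R) : Prop :=
  [/\ noetherian_ring, maximal_ideal M & forall N, maximal_ideal N -> N = M].

Definition is_field : Prop := forall x : R, x != 0 -> exists y, x * y = 1.

Definition annihilator (x : R) : set R := [set r | r * x = 0].

Definition associated_prime : set (set R) :=
  [set P | prime_ideal P /\ exists x, P = annihilator x].

Definition prime_subring : set R := range (fun z : int => z%:~R : R).

Definition ideal_mul I J : set R := ideal_span [set x * y | x in I & y in J].

Definition ideal_pow I (n : nat) : set R := iter n (ideal_mul I) setT.

End Ideals.

Section IdealTheory.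
Variable R : comNzRingType.
Implicit Types (I J : set R).

Lemma idealP I : ideal I <->
  [/\ I 0, forall x y, I x -> I y -> I (x + y) & forall a x, I x -> I (a * x)].
Proof.
split=> [[I0 Il]|[I0 ID IM]].
- have {}I0 : I 0 by rewrite inE in I0.
  have Il' a u v : I u -> I v -> I (a * u + v).
    by move=> Iu Iv; have := Il a u v; rewrite !inE; apply.
  split=> // [x y Ix Iy|a x Ix]; first by rewrite -[x]mul1r; apply: Il'.
  by rewrite -[_ * _]addr0; apply: Il'.
- split=> [|a u v]; first by rewrite inE.
  by rewrite !inE => Iu Iv; apply: ID => //; apply: IM.
Qed.

Lemma ideal_span_ideal (S : set R) : ideal (ideal_span S).
Proof.
apply/idealP; split=> [J [/idealP[J0 _ _] _] //|x y Sx Sy J|a x Sx J].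
- move=> JS; have [/idealP[_ JD _] _] := JS.
  by apply: JD; [apply: Sx|apply: Sy].
- by move=> JS; have [/idealP[_ _ JM] _] := JS; apply: JM; apply: Sx.
Qed.

Lemma ideal_pow_ideal I n : ideal (ideal_pow I n).
Proof.
by case: n => [|n]; [apply/idealP; split|apply: ideal_span_ideal].
Qed.

Lemma ideal_powB I n x y :
  ideal_pow I n x -> ideal_pow I n y -> ideal_pow I n (x - y).
Proof.
have /idealP[_ pD pM] := ideal_pow_ideal I n.
by move=> px py; rewrite -mulN1r; apply: pD => //; apply: pM.
Qed.

End IdealTheory.

(* The I-adic completion: I-adic Cauchy sequences modulo I-adic null
   sequences. *)

Section AdicCompletion.
Variables (R : comNzRingType) (I : set R).

Definition adic_cauchy (u : nat -> R) : bool :=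
  `[< forall n, exists N, forall i j, (N <= i)%N -> (N <= j)%N ->
        ideal_pow I n (u i - u j) >].

Lemma adic_cauchy_subring : subring_closed adic_cauchy.
Proof.
split=> [|u v /asboolP cu /asboolP cv|u v /asboolP cu /asboolP cv].
- apply/asboolP => n; exists 0%N => i j _ _.
  by have /idealP[p0 _ _] := ideal_pow_ideal I n; rewrite subrr.
- apply/asboolP => n; have [N1 h1] := cu n; have [N2 h2] := cv n.
  exists (maxn N1 N2) => i j; rewrite !geq_max => /andP[i1 i2] /andP[j1 j2].
  have -> : (u - v) i - (u - v) j = (u i - u j) - (v i - v j).
    rewrite -[(u - v) i]/(u i - v i) -[(u - v) j]/(u j - v j).
    by rewrite opprD addrACA -opprD.
  by apply: ideal_powB; [apply: h1|apply: h2].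
- apply/asboolP => n; have [N1 h1] := cu n; have [N2 h2] := cv n.
  exists (maxn N1 N2) => i j; rewrite !geq_max => /andP[i1 i2] /andP[j1 j2].
  have -> : (u * v) i - (u * v) j = v i * (u i - u j) + u j * (v i - v j).
    rewrite -[(u * v) i]/(u i * v i) -[(u * v) j]/(u j * v j) !mulrBr.
    by rewrite [v i * u i]mulrC [v i * u j]mulrC addrA subrK.
  have /idealP[_ pD pM] := ideal_pow_ideal I n.
  by apply: pD; apply: pM; [apply: h1|apply: h2].
Qed.

HB.instance Definition _ :=
  GRing.isSubringClosed.Build (nat -> R) adic_cauchy adic_cauchy_subring.

Record cauchy_seq := CauchySeq {
  cauchy_val :> nat -> R;
  cauchy_valP : cauchy_val \in adic_cauchy }.

HB.instance Definition _ := [isSub for cauchy_val].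
HB.instance Definition _ := [Choice of cauchy_seq by <:].
HB.instance Definition _ :=
  [SubChoice_isSubComNzRing of cauchy_seq by <:].

Definition adic_null (u : cauchy_seq) : bool :=
  `[< forall n, exists N, forall i, (N <= i)%N -> ideal_pow I n (u i) >].

Lemma adic_null_zmod : zmod_closed adic_null.
Proof.
split=> [|u v /asboolP nu /asboolP nv]; apply/asboolP => n.
  by exists 0%N => i _; have /idealP[] := ideal_pow_ideal I n.
have [N1 h1] := nu n; have [N2 h2] := nv n.
exists (maxn N1 N2) => i; rewrite geq_max => /andP[i1 i2].
by apply: ideal_powB; [apply: h1|apply: h2].
Qed.

HB.instance Definition _ :=
  GRing.isZmodClosed.Build cauchy_seq adic_null adic_null_zmod.

Lemma adic_nullM (a u : cauchy_seq) : u \in adic_null -> a * u \in adic_null.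
Proof.
move=> /asboolP nu; apply/asboolP => n; have [N h] := nu n.
exists N => i Ni; have /idealP[_ _ pM] := ideal_pow_ideal I n.
by apply: pM; apply: h.
Qed.

Local Open Scope quotient_scope.

(* [{ideal_quot _}] would require the null sequences to form a proper ideal;
   the ring structure is given here for arbitrary [I]. *)
Definition completion : Type :=
  Quotient.quot (GRing.ZmodClosed.clone cauchy_seq adic_null _).

HB.instance Definition _ := GRing.Zmodule.on completion.
HB.instance Definition _ := EqQuotient.on completion.

Definition completion_one : completion := \pi_completion 1.
Definition completion_mul (x y : completion) : completion :=
  \pi_completion (repr x * repr y).

Let mulE (u v : cauchy_seq) :
  completion_mul (\pi_completion u) (\pi_completion v) = \pi_completion (u * v).
Proof.
apply/eqP; rewrite -Quotient.idealrBE.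
set u' := repr _; set v' := repr _.
have nu : u' - u \in adic_null by rewrite Quotient.idealrBE reprK.
have nv : v' - v \in adic_null by rewrite Quotient.idealrBE reprK.
have -> : u' * v' - u * v = v' * (u' - u) + u * (v' - v).
  by rewrite !mulrBr [v' * u']mulrC [v' * u]mulrC addrA subrK.
by apply: rpredD; apply: adic_nullM.
Qed.

Let addE (u v : cauchy_seq) :
  \pi_completion u + \pi_completion v = \pi_completion (u + v).
Proof. exact/esym/Quotient.pi_add. Qed.

Let mulA : associative completion_mul.
Proof.
elim/quotW=> x; elim/quotW=> y; elim/quotW=> z.
by rewrite (mulE y z) (mulE x) (mulE x y) mulE mulrA.
Qed.

Let mulC : commutative completion_mul.
Proof. by move=> x y; rewrite /completion_mul mulrC. Qed.

Let mul1x : left_id completion_one completion_mul.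
Proof. by elim/quotW=> x; rewrite mulE mul1r. Qed.

Let mulDl : left_distributive completion_mul +%R.
Proof.
elim/quotW=> x; elim/quotW=> y; elim/quotW=> z.
by rewrite (addE x y) (mulE x z) (mulE y z) mulE addE mulrDl.
Qed.

HB.instance Definition _ :=
  GRing.Zmodule_isComPzRing.Build completion mulA mulC mul1x mulDl.

Definition completion_class (u : cauchy_seq) : completion := \pi_completion u.

Lemma completion_class_is_zmod_morphism : zmod_morphism completion_class.
Proof.
move=> u v; apply/esym/eqP; rewrite subr_eq /completion_class addE subrK.
exact: eqxx.
Qed.

Lemma completion_class_is_monoid_morphism : monoid_morphism completion_class.
Proof. by split=> // u v; symmetry; exact: mulE. Qed.

HB.instance Definition _ := GRing.isZmodMorphism.Build
  cauchy_seq completion completion_class completion_class_is_zmod_morphism.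
HB.instance Definition _ := GRing.isMonoidMorphism.Build
  cauchy_seq completion completion_class completion_class_is_monoid_morphism.

Lemma completion_classE (u v : cauchy_seq) :
  completion_class u = completion_class v <-> u - v \in adic_null.
Proof.
by rewrite Quotient.idealrBE; split=> [|/eqP] e; [apply/eqP|].
Qed.

Lemma cst_adic_cauchy (a : R) : (fun=> a) \in adic_cauchy.
Proof.
apply/asboolP => n; exists 0%N => i j _ _; rewrite subrr.
by have /idealP[] := ideal_pow_ideal I n.
Qed.

Definition to_completion (a : R) : completion :=
  completion_class (CauchySeq (cst_adic_cauchy a)).

Lemma to_completion_is_zmod_morphism : zmod_morphism to_completion.
Proof.
move=> a b; rewrite /to_completion -rmorphB; congr completion_class.
exact: val_inj.
Qed.

Lemma to_completion_is_monoid_morphism : monoid_morphism to_completion.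
Proof.
split=> [|a b]; first by rewrite /to_completion -(rmorph1 completion_class);
  congr completion_class; exact: val_inj.
rewrite /to_completion -rmorphM; congr completion_class; exact: val_inj.
Qed.

HB.instance Definition _ := GRing.isZmodMorphism.Build
  R completion to_completion to_completion_is_zmod_morphism.
HB.instance Definition _ := GRing.isMonoidMorphism.Build
  R completion to_completion to_completion_is_monoid_morphism.

Definition adically_complete : Prop := bijective to_completion.

End AdicCompletion.

(* Functoriality: a ring morphism f : R -> S induces a map from the completion
   of R at f^-1(J) to the completion of S at J. *)

Section CompletionMap.
Variables (R S : comNzRingType) (f : {rmorphism R -> S}) (J : set S).

Lemma ideal_pow_preimage n a :
  ideal_pow (f @^-1` J) n a -> ideal_pow J n (f a).
Proof.
elim: n a => [//|n IHn] a.
suff: ideal_pow (f @^-1` J) n.+1 `<=` f @^-1` ideal_pow J n.+1 by apply.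
apply: smallest_sub.
  have /idealP[p0 pD pM] := ideal_pow_ideal J n.+1.
  apply/idealP; split=> [|x y|b x] /=; first by rewrite rmorph0.
    by rewrite rmorphD; apply: pD.
  by rewrite rmorphM; apply: pM.
move=> _ [x Jx [y py <-]] K [_]; rewrite /= rmorphM; apply.
by exists (f x) => //; exists (f y) => //; apply: IHn.
Qed.

Lemma map_adic_cauchy (u : cauchy_seq (f @^-1` J)) :
  (fun n => f (u n)) \in adic_cauchy J.
Proof.
apply/asboolP => n; have /asboolP/(_ n)[N h] := valP u.
exists N => i j Ni Nj; rewrite -rmorphB; apply: ideal_pow_preimage.
exact: h.
Qed.

Definition completion_map (x : completion (f @^-1` J)) : completion J :=
  completion_class (CauchySeq (map_adic_cauchy (repr x))).

Lemma completion_mapE (u : cauchy_seq (f @^-1` J)) :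
  completion_map (completion_class u) =
  completion_class (CauchySeq (map_adic_cauchy u)).
Proof.
apply/completion_classE/asboolP => n.
have : repr (completion_class u) - u \in @adic_null R (f @^-1` J).
  by apply/completion_classE; rewrite /completion_class reprK.
move=> /asboolP/(_ n)[N h]; exists N => i Ni.
rewrite -[X in ideal_pow J n X]/(f (repr (completion_class u) i) - f (u i)).
rewrite -rmorphB; apply: ideal_pow_preimage; exact: h.
Qed.

Local Open Scope quotient_scope.

Lemma completion_classW (P : completion (f @^-1` J) -> Prop) :
  (forall u, P (completion_class u)) -> forall x, P x.
Proof. by move=> Pc x; rewrite -[x]reprK; apply: Pc. Qed.

Lemma completion_map_is_zmod_morphism : zmod_morphism completion_map.
Proof.
elim/completion_classW=> u; elim/completion_classW=> v.
rewrite -rmorphB !completion_mapE -rmorphB; congr completion_class.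
by apply: val_inj; apply/funext => n; apply: rmorphB.
Qed.

Lemma completion_map_is_monoid_morphism : monoid_morphism completion_map.
Proof.
split.
  rewrite -(rmorph1 (@completion_class R (f @^-1` J))) completion_mapE.
  rewrite -(rmorph1 (@completion_class S J)); congr completion_class.
  by apply: val_inj; apply/funext => n; apply: rmorph1.
elim/completion_classW=> u; elim/completion_classW=> v.
rewrite -rmorphM !completion_mapE -rmorphM; congr completion_class.
by apply: val_inj; apply/funext => n; apply: rmorphM.
Qed.

HB.instance Definition _ := GRing.isZmodMorphism.Build
  (completion (f @^-1` J)) (completion J) completion_map
  completion_map_is_zmod_morphism.
HB.instance Definition _ := GRing.isMonoidMorphism.Build
  (completion (f @^-1` J)) (completion J) completion_map
  completion_map_is_monoid_morphism.

(* The composite of [completion_map] with the inverse of [to_completion J],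
   i.e. the limit in S of a Cauchy sequence of R. It is meaningful, and a ring
   morphism, when S is J-adically complete. *)
Definition natural_map (x : completion (f @^-1` J)) : S :=
  xget 0 [set t | to_completion J t = completion_map x].

Lemma natural_mapE (completeS : adically_complete J) x :
  to_completion J (natural_map x) = completion_map x.
Proof.
rewrite /natural_map; case: xgetP => // noS.
by have [g _ gK] := completeS; case: (noS (g (completion_map x))); apply: gK.
Qed.

Lemma natural_map_is_zmod_morphism (completeS : adically_complete J) :
  zmod_morphism natural_map.
Proof.
move=> x y; apply: (bij_inj completeS).
rewrite (natural_mapE completeS) [LHS]rmorphB [RHS]rmorphB.
by congr (_ - _); exact/esym/natural_mapE.
Qed.

Lemma natural_map_is_monoid_morphism (completeS : adically_complete J) :
  monoid_morphism natural_map.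
Proof.
split=> [|x y]; apply: (bij_inj completeS).
  by rewrite (natural_mapE completeS) !rmorph1.
rewrite (natural_mapE completeS) [LHS]rmorphM [RHS]rmorphM.
by congr (_ * _); exact/esym/natural_mapE.
Qed.

End CompletionMap.

Definition generic_formal_fiber (A T : comNzRingType) (f : A -> T) :
  set (set T) := [set Q | prime_ideal Q /\ f @^-1` Q = [set 0]].

(* Main.v *)
Require Import Defs.
From HB Require Import structures.
From mathcomp Require Import all_boot all_order all_algebra.
From mathcomp Require Import boolp classical_sets functions cardinality wochoice.
From mathcomp Require Import ring.

Set Implicit Arguments.
Unset Strict Implicit.
Unset Printing Implicit Defensive.

Import GRing.Theory.

Local Open Scope classical_set_scope.
Local Open Scope ring_scope.

(** If [A] is as required then [A] meets every prime of [G] in zero, so [G] is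
    closed under generalisation and its members contain no nonzero element of
    the prime subring. If moreover [M] belongs to [G], the maximal ideal of [A]
    is zero, [A] is a field, and [T] is [A] itself. If not, the associated
    primes of [T] lie in [G] because the completion of a Noetherian domain is
    torsion-free ([completion_torsion_free]), which follows from a weak
    Artin-Rees lemma for principal ideals ([artin_rees_principal]).

    Conversely, if [T] is a field take [A = T]. In the other case let [Q_1],
    ..., [Q_n] be the maximal elements of [G]; then [G] is the set of primes
    contained in some [Q_i]. All zero divisors of [T] lie in the union of the
    [Q_i]. It suffices to find a subring [R] of [T] that meets each [Q_i] in
    zero and satisfies [R + fT = T] for all [f] outside that union. Indeed, let
    [A] be the set of the quotients of elements of [R] that lie in [T]
    ([division_closure]). It has the same two properties and [A] meets [aT] in
    [aA] for all [a] in [A], so that [A / aA = T / aT] for every nonzero [a] in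
    [A]. Hence [A] is Noetherian and local, [T] is its completion, and each
    ideal outside the [Q_i] contains a nonzero element of [A]
    ([dense_noetherian], [dense_completion], [dense_meets_principal]).

    The ring [R] is generated by one element of each coset [u + fT] with [f]
    outside the union. These are chosen by transfinite recursion, so that each
    is transcendental modulo every [Q_i] over the ring generated by the
    preceding ones ([dense_avoiding_subring]). This is possible because fewer
    than [|T|] elements have been chosen before, so that fewer than [|T|]
    elements are algebraic over them modulo [Q_i], as [T] is uncountable,
    whereas the coset has [|T|] elements modulo [Q_i]
    ([transcendental_in_coset]). For the latter, [T] is no larger than the set
    of sequences of residues modulo [M], because it is complete with finitely
    generated maximal ideal, and these sequences inject into [T / Q_i] as the
    coefficients of power series in an element of [M] outside the [Q_i]
    ([coset_injection]). *)

(** * Infinite cardinals *)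

Lemma zorn_chain2 X (F : set (set X)) (p q : X) :
  total_on F subset -> (\bigcup_(S in F) S) p -> (\bigcup_(S in F) S) q ->
  exists S, [/\ F S, S p & S q].
Proof.
move=> totF [S FS Sp] [S' FS' S'q].
by have [SS'|S'S] := totF _ _ FS FS'; [exists S'|exists S]; split; auto.
Qed.

(** A maximal partial bijection between the two sets exhausts one of them. *)
Lemma injection_total X (A B : set X) :
  (exists f : X -> X, {in A &, injective f} /\ (forall a, A a -> B (f a))) \/
  (exists f : X -> X, {in B &, injective f} /\ (forall b, B b -> A (f b))).
Proof.
pose P (S : set (X * X)) := (forall p, S p -> A p.1 /\ B p.2) /\
  (forall p q, S p -> S q -> p.1 = q.1 <-> p.2 = q.2).
have [|S [[SAB Sinj] Smax]] := @Zorn_bigcup _ P.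
  move=> F FP totF; split=> [p [S FS Sp]|p q Fp Fq].
    by have [+ _] := FP _ FS; apply.
  have [S [FS Sp Sq]] := zorn_chain2 totF Fp Fq.
  by have [_] := FP _ FS; apply.
have [domS|/existsNP[a /not_implyP[Aa noa]]] :=
  pselect (forall a, A a -> exists b, S (a, b)).
  have /choice[f fS] : forall a, exists b, A a -> S (a, b).
    move=> a; have [Aa|nAa] := pselect (A a); last by exists a.
    by have [b Sab] := domS a Aa; exists b.
  left; exists f; split=> [a a' Aa Aa' eqf|a Aa]; last exact: (SAB _ (fS a Aa)).2.
  rewrite !inE in Aa Aa'; exact: (Sinj _ _ (fS a Aa) (fS a' Aa')).2 eqf.
have [ranS|/existsNP[b /not_implyP[Bb nob]]] :=
  pselect (forall b, B b -> exists a, S (a, b)).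
  have /choice[f fS] : forall b, exists a, B b -> S (a, b).
    move=> b; have [Bb|nBb] := pselect (B b); last by exists b.
    by have [a' Sab] := ranS b Bb; exists a'.
  right; exists f; split=> [b b' Bb Bb' eqf|b Bb]; last exact: (SAB _ (fS b Bb)).1.
  rewrite !inE in Bb Bb'; exact: (Sinj _ _ (fS b Bb) (fS b' Bb')).1 eqf.
case: (Smax (S `|` [set (a, b)])).
  split=> [p Sp|/(_ (a, b))]; first by left.
  by move=> /(_ (or_intror erefl)) Sab; case: noa; exists b.
split=> [p [/SAB //|-> //]|p q [Sp|->] [Sq|->]] //; first exact: Sinj.
- split=> /= e; first by case: noa; exists p.2; rewrite -e -surjective_pairing.
  by case: nob; exists p.1; rewrite -e -surjective_pairing.
- split=> /= e; first by case: noa; exists q.2; rewrite e -surjective_pairing.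
  by case: nob; exists q.1; rewrite e -surjective_pairing.
Qed.

Section Square.
Variables (X : Type) (iota : nat -> X).
Hypothesis iota_inj : injective iota.

Let field_of (S : set (X * X * X)) : set X := [set a | exists c, S (a, a, c)].

(* The graph of an injection from [Y * Y] into [Y], where [Y] is the set of
   the points on which the graph is defined: graphs, unlike functions, have
   unions along chains. *)
Let pairing S : Prop := [/\ forall a b, field_of S a -> field_of S b ->
    exists c, S (a, b, c),
  forall a b c, S (a, b, c) -> [/\ field_of S a, field_of S b & field_of S c] &
  forall p q, S p -> S q -> p.2 = q.2 -> p.1 = q.1].

Let code_nat (p : nat * nat) := pickle p.

Let natS : set (X * X * X) := [set p | exists m n, p =
  (iota m, iota n, iota (code_nat (m, n)))].

Let natS_field a : field_of natS a <-> exists n, a = iota n.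
Proof.
split=> [[c [m [n [-> _ _]]]]|[n ->]]; first by exists m.
by exists (iota (code_nat (n, n))); exists n, n.
Qed.

Let pairing_natS : pairing natS.
Proof.
split=> [a b /natS_field[m ->] /natS_field[n ->]|a b c [m [n [-> -> ->]]]|].
- by exists (iota (code_nat (m, n))); exists m, n.
- by split; apply/natS_field; [exists m|exists n|exists (code_nat (m, n))].
- move=> _ _ [m [n ->]] [m' [n' ->]] /= /iota_inj.
  by move=> /(pcan_inj pickleK)[-> ->].
Qed.

Let pairing_max : exists S, [/\ pairing S, natS `<=` S &
  forall S', pairing S' -> S `<=` S' -> S' `<=` S].
Proof.
have [|S [pS Smax]] := @Zorn_bigcup _ [set S | pairing (S `|` natS)].
  move=> F FP totF; rewrite /=.
  have [F0|/existsNP[S0 /contrapT FS0]] := pselect (forall S, ~ F S).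
    have -> : \bigcup_(S in F) S = set0.
      by apply/seteqP; split=> // p [S /F0].
    by rewrite set0U; apply: pairing_natS.
  have -> : \bigcup_(S in F) S `|` natS = \bigcup_(S in [set S `|` natS | S in F]) S.
    apply/seteqP; split=> [p [[S FS Sp]|np]|p [_ [S FS <-] [Sp|np]]].
    - by exists (S `|` natS); [exists S|left].
    - by exists (S0 `|` natS); [exists S0|right].
    - by left; exists S.
    - by right.
  set F' := [set S `|` natS | S in F].
  have {}totF : total_on F' subset.
    move=> _ _ [S FS <-] [S' FS' <-]; have [SS'|S'S] := totF _ _ FS FS'.
      by left; apply: setSU.
    by right; apply: setSU.
  have {}FP S : F' S -> pairing S by move=> [S' FS' <-]; apply: FP.
  have fieldU S a : F' S -> field_of S a -> field_of (\bigcup_(S in F') S) a.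
    by move=> FS [c Sc]; exists c, S.
  split=> [a b [c Sc] [d Sd]|a b c [S FS Sabc]|p q Sp Sq].
  - have [S [FS Sac Sbd]] := zorn_chain2 totF Sc Sd.
    have [e Se] : exists e, S (a, b, e).
      by have [+ _ _] := FP _ FS; apply; [exists c|exists d].
    by exists e, S.
  - have [_ /(_ _ _ _ Sabc)[Sa Sb Sc] _] := FP _ FS.
    by split; apply: fieldU; eassumption.
  - have [S [FS Sp' Sq']] := zorn_chain2 totF Sp Sq.
    by have [_ _] := FP _ FS; apply.
exists (S `|` natS); split=> // S' pS' SS'.
apply: contrapT => S'S; case: (Smax S').
  split=> [p Sp|S'S2]; first by apply: SS'; left.
  by apply: S'S => p /S'S2 Sp; left.
rewrite /= (_ : S' `|` natS = S') //; apply/seteqP; split=> [p [//|np]|p S'p].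
  by apply: SS'; right.
by left.
Qed.

(** Take a maximal [Y] with an injection of its square into itself. Were the
    complement of [Y] to contain a copy of [Y], the injection would extend to
    the union of [Y] and this copy; so the complement is no larger than [Y], and
    the whole type embeds into [Y]. *)
Lemma square_injection : exists f : X * X -> X, injective f.
Proof.
have [S [[Stot Scl Sinj] natS_S Smax]] := pairing_max.
pose Y := field_of S.
have /choice[f fS] : forall p, exists c, Y p.1 -> Y p.2 -> S (p, c).
  move=> [a b] /=; have [Ya|nYa] := pselect (Y a); last by exists a.
  have [Yb|nYb] := pselect (Y b); last by exists b.
  by have [c Sc] := Stot a b Ya Yb; exists c.
have fY a b : Y a -> Y b -> Y (f (a, b)).
  by move=> Ya Yb; have [] := Scl _ _ _ (fS (a, b) Ya Yb).
have finj a b c d : Y a -> Y b -> Y c -> Y d -> f (a, b) = f (c, d) ->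
    a = c /\ b = d.
  move=> Ya Yb Yc Yd /(Sinj _ _ (fS (a, b) Ya Yb) (fS (c, d) Yc Yd)).
  by move=> [-> ->].
pose y0 := iota 0; pose y1 := iota 1.
have Yiota n : Y (iota n).
  by exists (iota (code_nat (n, n))); apply: natS_S; exists n, n.
have y01 : y0 <> y1 by move=> /iota_inj.
have tagP (P P' : Prop) : (if pselect P then y0 else y1) =
    (if pselect P' then y0 else y1) -> (P <-> P').
  by case: pselect; case: pselect => // ? ? /= e; case: y01; rewrite e.
have tagY (P : Prop) : Y (if pselect P then y0 else y1).
  by case: pselect => ? /=; apply: Yiota.
have [[h [hinj hY]]|[h [hinj hZ]]] := injection_total (~` Y) Y.
  (* the tags [y0] and [y1] separate the points of [Y] from the others *)
  pose base a := if pselect (Y a) then a else h a.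
  pose g a := f (if pselect (Y a) then y0 else y1, base a).
  have baseY a : Y (base a) by rewrite /base; case: pselect => [//|nYa] /=; apply: hY.
  have gY a : Y (g a) by apply: fY.
  have ginj : injective g.
    move=> a b /finj[] // tt; have tab := tagP _ _ tt; rewrite /base.
    case: pselect => Ya; case: pselect => Yb /=;
      [by []|by case: Yb; apply/tab|by case: Ya; apply/tab|].
    by apply: hinj; rewrite inE.
  exists (fun p => f (g p.1, g p.2)) => -[a b] [c d] /= /finj[] //.
  by move=> /ginj-> /ginj->.
exfalso.
(* new pairs are coded in [Y] as above, and then moved by [h] out of [Y] *)
pose Y' := Y `|` h @` Y.
have /choice[k kP] : forall a, exists b, Y' a -> ~ Y a -> Y b /\ h b = a.
  move=> a; have [[b Yb hb]|noa] := pselect ((h @` Y) a); first by exists b.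
  by exists a => -[].
pose base a := if pselect (Y a) then a else k a.
pose g a := f (if pselect (Y a) then y0 else y1, base a).
have baseY a : Y' a -> Y (base a).
  by rewrite /base; case: pselect => [//|nYa] /= Y'a; case: (kP _ Y'a nYa).
have gY a : Y' a -> Y (g a) by move=> Y'a; apply: fY => //; apply: baseY.
have ginj a b : Y' a -> Y' b -> g a = g b -> a = b.
  move=> Y'a Y'b /finj[] //; [exact: baseY|exact: baseY|move=> tt].
  have tab := tagP _ _ tt.
  rewrite /base; case: pselect => Ya; case: pselect => Yb /=;
    [by []|by case: Yb; apply/tab|by case: Ya; apply/tab|].
  have [_ ea] := kP _ Y'a Ya; have [_ eb] := kP _ Y'b Yb.
  by move=> e; rewrite -ea -eb e.
pose S' := S `|` [set p | exists a b, [/\ Y' a, Y' b, ~ (Y a /\ Y b) &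
  p = (a, b, h (f (g a, g b)))]].
have hfY' a b : Y' a -> Y' b -> Y' (h (f (g a, g b))).
  by move=> Y'a Y'b; right; exists (f (g a, g b)) => //; apply: fY; apply: gY.
have field' a : field_of S' a <-> Y' a.
  split=> [[c [Sc|[b [b' [Y'b _ _ [-> _ _]]]]]]|Y'a] //.
    by left; exists c.
  have [[c Sc]|nYa] := pselect (Y a); first by exists c; left.
  by exists (h (f (g a, g a))); right; exists a, a; split=> // -[].
have : S' `<=` S.
  apply: Smax; last by move=> p Sp; left.
  split=> [a b /field' Y'a /field' Y'b|a b c [Sabc|[a' [b' [Y'a Y'b _]]]]|p q].
  - have [[Ya Yb]|nY] := pselect (Y a /\ Y b).
      by exists (f (a, b)); left; apply: fS.
    by exists (h (f (g a, g b))); right; exists a, b.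
  - by have [Ya Yb Yc] := Scl _ _ _ Sabc; split; apply/field'; left.
  - move=> [-> -> ->]; split; apply/field' => //; exact: hfY'.
  - have YS p' : S p' -> Y p'.2.
      by move: p' => [[a b] c] /Scl[].
    move=> [Sp|[a [b [Y'a Y'b nY ->]]]] [Sq|[a' [b' [Y'a' Y'b' nY' ->]]]] /=.
    + exact: Sinj.
    + move=> e; have := YS _ Sp; rewrite e => Yh.
      by case: (hZ (f (g a', g b')) _) => //; apply: fY; apply: gY.
    + move=> e; have := YS _ Sq; rewrite -e => Yh.
      by case: (hZ (f (g a, g b)) _) => //; apply: fY; apply: gY.
    + have Yab : Y (f (g a, g b)) by apply: fY; apply: gY.
      have Yab' : Y (f (g a', g b')) by apply: fY; apply: gY.
      move=> /hinj; rewrite !inE => /(_ Yab Yab') /finj[]; try exact: gY.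
      by move=> /ginj-> // /ginj->.
have hy0 : ~ Y (h y0) by apply: hZ; apply: Yiota.
have Y'h : Y' (h y0) by right; exists y0 => //; apply: Yiota.
move=> /(_ (h y0, h y0, h (f (g (h y0), g (h y0))))) S'S.
have /Scl[/hy0//] : S (h y0, h y0, h (f (g (h y0), g (h y0)))).
by apply: S'S; right; exists (h y0), (h y0); split=> // -[].
Qed.

Lemma seq_injection : exists f : seq X -> X, injective f.
Proof.
have [f finj] := square_injection.
pose enc := foldr (fun x c => f (x, c)) (iota 0).
have enc_inj s t : size s = size t -> enc s = enc t -> s = t.
  elim: s t => [|x s IHs] [|y t] //= [eqsz] /finj[-> e].
  by rewrite (IHs t).
exists (fun s => f (iota (size s), enc s)) => s t /finj[/iota_inj].
exact: enc_inj.
Qed.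

Lemma sum_injection : exists f : nat + X -> X, injective f.
Proof.
have [f finj] := square_injection.
exists (fun u => match u with
  | inl n => f (iota 0, iota n) | inr x => f (iota 1, x) end).
by move=> [m|x] [n|y] /finj[] // => [/iota_inj->|/iota_inj|/iota_inj|->].
Qed.

End Square.

(** * Ideals and Noetherian rings *)

Section IdealClosure.
Variables (R : comNzRingType) (I : set R).
Hypothesis idI : ideal I.

Lemma ideal0 : I 0. Proof. by case/idealP: idI. Qed.

Lemma idealD x y : I x -> I y -> I (x + y).
Proof. by case/idealP: idI => _ + _; apply. Qed.

Lemma idealMl a x : I x -> I (a * x).
Proof. by case/idealP: idI => _ _; apply. Qed.

Lemma idealMr a x : I x -> I (x * a).
Proof. by rewrite mulrC; apply: idealMl. Qed.

Lemma idealN x : I x -> I (- x).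
Proof. by rewrite -mulN1r; apply: idealMl. Qed.

Lemma idealB x y : I x -> I y -> I (x - y).
Proof. by move=> Ix Iy; apply: idealD => //; apply: idealN. Qed.

Lemma idealB_sym x y : I (x - y) -> I (y - x).
Proof. by move=> Ixy; rewrite -opprB; apply: idealN. Qed.

Lemma idealDr x y : I (x + y) -> I y -> I x.
Proof. by move=> Ixy Iy; rewrite -[x](addrK y); apply: idealB. Qed.

End IdealClosure.

Section Ideals.
Variable R : comNzRingType.
Implicit Types (I J E P Q M : set R) (s : seq R) (C : set (set R)).

Lemma ideal_spanS (S : set R) : S `<=` ideal_span S.
Proof. exact: sub_smallest. Qed.

Lemma ideal_span_sub (S : set R) I : ideal I -> S `<=` I -> ideal_span S `<=` I.
Proof. exact: smallest_sub. Qed.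

Lemma principal_ideal (x : R) : ideal (range ( *%R x)).
Proof.
apply/idealP; split=> [|_ _ [y _ <-] [z _ <-]|a _ [y _ <-]].
- by exists 0; rewrite ?mulr0.
- by exists (y + z); rewrite ?mulrDr.
- by exists (a * y); rewrite // mulrCA.
Qed.

Lemma ideal_one I : ideal I -> I 1 -> I = setT.
Proof.
by move=> idI I1; apply/seteqP; split=> // x _; rewrite -[x]mulr1; apply: idealMl.
Qed.

Lemma prime_idealP P : prime_ideal P <->
  [/\ ideal P, ~ P 1 & forall x y, P (x * y) -> P x \/ P y].
Proof.
split=> [[[P0 P1 PD] PM]|[idP P1 PM]].
- split=> [||x y].
  + by split=> // a u v Pu Pv; apply: PD.
  + by move: P1; rewrite notin_setE.
  + by have := PM x y; rewrite !inE => + Pxy => /(_ Pxy)/orP; rewrite !inE.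
- split; [split|] => [|||u v].
  + by rewrite inE; apply: ideal0.
  + by rewrite notin_setE.
  + move=> a u v; rewrite !inE => Pu Pv.
    by apply: idealD => //; apply: idealMl.
  + by rewrite inE => /PM[]Pu; apply/orP; [left|right]; rewrite inE.
Qed.

Section Prime.
Variable P : set R.
Hypothesis prP : prime_ideal P.

Lemma prime_ideal_ideal : ideal P. Proof. by case/prime_idealP: prP. Qed.

Lemma prime_ideal1 : ~ P 1. Proof. by case/prime_idealP: prP. Qed.

Lemma prime_idealM x y : P (x * y) -> P x \/ P y.
Proof. by case/prime_idealP: prP => _ _; apply. Qed.

Lemma prime_idealMN x y : ~ P x -> ~ P y -> ~ P (x * y).
Proof. by move=> Px Py /prime_idealM[]. Qed.

End Prime.

(** The ascending chain condition: a strictly increasing sequence of ideals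
    stops at the stage containing finitely many generators of its union. *)
Lemma noetherian_maximal C : noetherian_ring R ->
  C `<=` @ideal R -> C !=set0 -> maximal_elements C !=set0.
Proof.
move=> noethR Cid [I0 CI0]; apply: contrapT => nomax.
have /choice[next nextP] : forall I, exists J, C I -> [/\ C J, I `<=` J & ~ J `<=` I].
  move=> I; have [CI|nCI] := pselect (C I); last by exists I.
  apply: contrapT => /forallNP noJ; apply: nomax; exists I; split=> // J CJ IJ.
  apply/seteqP; split=> //; apply: contrapT => nJI.
  by apply: (noJ J) => _; split.
pose F n := iter n next I0.
have CF n : C (F n) by elim: n => //= n /nextP[].
have F_mono m n : (m <= n)%N -> F m `<=` F n.
  move=> /subnK <-; elim: (n - m)%N => [//|k IHk] x /IHk.
  by have [_ + _] := nextP _ (CF (k + m)%N); apply.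
have idF n : ideal (F n) by apply: Cid.
pose U := \bigcup_n F n.
have idU : ideal U.
  apply/idealP; split=> [|x y [m _ Fx] [n _ Fy]|a x [n _ Fx]].
  - by exists 0%N => //; apply: ideal0.
  - exists (maxn m n) => //; apply: idealD => //.
      by apply: F_mono Fx; rewrite leq_maxl.
    by apply: F_mono Fy; rewrite leq_maxr.
  - by exists n => //; apply: idealMl.
have [s Us] := noethR U idU.
have [n Fs] : exists n, [set` s] `<=` F n.
  have : [set` s] `<=` U by rewrite Us; apply: ideal_spanS.
  elim: s {Us} => [|x s IHs] sU; first by exists 0%N.
  have [y /= ys|m Fm] := IHs.
    by apply: sU; rewrite /= inE ys orbT.
  have [n _ Fn] : U x by apply: sU; rewrite /= inE eqxx.
  exists (maxn m n) => y; rewrite /= inE => /orP[/eqP->|ys].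
    by apply: F_mono Fn; rewrite leq_maxr.
  by apply: (F_mono m); rewrite ?leq_maxl //; apply: Fm.
have [_ _] := nextP _ (CF n); apply=> x Fx.
have : U x by exists n.+1.
by rewrite Us; apply: ideal_span_sub.
Qed.

Lemma noetherian_maximal_above C I : noetherian_ring R ->
  C `<=` @ideal R -> C I -> exists2 J, maximal_elements C J & I `<=` J.
Proof.
move=> noethR Cid CI.
have [|| J [[CJ IJ] Jmax]] := @noetherian_maximal (C `&` [set J | I `<=` J]) noethR.
- by move=> J [/Cid].
- by exists I; split.
exists J => //; split=> // J' CJ' JJ'; apply: Jmax => //; split=> //.
exact: subset_trans JJ'.
Qed.

(** An annihilator that is maximal among those of nonzero elements is prime. *)
Lemma zero_divisor_associated (a x : R) : noetherian_ring R ->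
  a * x = 0 -> x <> 0 -> exists2 P, associated_prime P & P a.
Proof.
move=> noethR ax0 x0.
have idann (y : R) : ideal (annihilator y).
  rewrite /annihilator; apply/idealP; split=> [|b c /= by0 cy0|b c /= cy0].
  - exact: mul0r.
  - by rewrite mulrDl by0 cy0 addr0.
  - by rewrite -mulrA cy0 mulr0.
have [|| P [[y [y0 ay0 ->]] Pmax]] := @noetherian_maximal
    [set I | exists y, [/\ y <> 0, a * y = 0 & I = annihilator y]] noethR.
- by move=> _ [y [_ _ ->]]; apply: idann.
- by exists (annihilator x), x.
exists (annihilator y) => //; split; last by exists y.
apply/prime_idealP; split=> // [|b c]; first by rewrite /annihilator /= mul1r.
rewrite /annihilator /= => bcy0.
have [cy0|cy0] := pselect (c * y = 0); [by right|left].
have e : annihilator (c * y) = annihilator y.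
  apply: Pmax; first by exists (c * y); split=> //; rewrite mulrCA ay0 mulr0.
  by move=> d; rewrite /annihilator /= mulrCA => ->; rewrite mulr0.
suff: annihilator y b by [].
by rewrite -e /annihilator /= mulrA.
Qed.

(** If one of the primes lies in the first of them it can be dropped; otherwise
    an element of the ideal avoiding all but the first prime is corrected by a
    product that lies in all the others but not in the first. *)
Lemma prime_avoidance I (s : seq (set R)) : ideal I ->
  (forall Q, Q \in s -> prime_ideal Q /\ ~ I `<=` Q) ->
  exists2 x, I x & forall Q, Q \in s -> ~ Q x.
Proof.
move=> idI; have [n] := ubnP (size s); elim: n s => [//|n IHn] [|Q s].
  by move=> _ _; exists 0; first exact: ideal0.
rewrite /= ltnS => sz prs.
have [prQ IQ] : prime_ideal Q /\ ~ I `<=` Q by apply: prs; rewrite inE eqxx.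
have idQ := prime_ideal_ideal prQ.
have [[Q' Q's Q'Q]|noQ'] := pselect (exists2 Q', Q' \in s & Q' `<=` Q).
  have [|Q1 Q1s|x Ix xs] := IHn (Q :: rem Q' s).
  - by rewrite /= size_rem // prednK //; case: (s) Q's.
  - apply: prs; move: Q1s; rewrite !inE => /orP[->//|/mem_rem->].
    by rewrite orbT.
  exists x => // Q1; rewrite inE => /orP[/eqP->|].
    by apply: xs; rewrite inE eqxx.
  have [->|Q1Q'] := eqVneq Q1 Q'.
    by move=> _ /Q'Q; apply: xs; rewrite inE eqxx.
  move=> Q1s; apply: xs; rewrite inE; apply/orP; right.
  by move: Q1s; rewrite (perm_mem (perm_to_rem Q's)) inE (negPf Q1Q').
have [|Q1 Q1s|x Ix xs] := IHn s => //; first by apply: prs; rewrite inE Q1s orbT.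
have [Qx|nQx] := pselect (Q x); last first.
  by exists x => // Q1; rewrite inE => /orP[/eqP->|/xs].
have [z Iz [Qz zs]] : exists2 z, I z & ~ Q z /\ forall Q1, Q1 \in s -> Q1 z.
  have {}noQ' Q' : Q' \in s -> ~ Q' `<=` Q by move=> ? ?; apply: noQ'; exists Q'.
  have {}prs Q1 : Q1 \in s -> prime_ideal Q1.
    by move=> Q1s; have [] := prs Q1 _; rewrite // inE Q1s orbT.
  move: noQ' prs; clear -idI IQ prQ; elim: s => [|Q' s IHs] noQ' prs.
    by have /existsNP[z /not_implyP[Iz Qz]] := IQ; exists z.
  have [Q1 Q1s|Q1 Q1s|z Iz [Qz zs]] := IHs.
  - by apply: noQ'; rewrite inE Q1s orbT.
  - by apply: prs; rewrite inE Q1s orbT.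
  have /existsNP[y /not_implyP[Q'y Qy]] : ~ Q' `<=` Q.
    by apply: noQ'; rewrite inE eqxx.
  have idall Q1 : Q1 \in Q' :: s -> ideal Q1.
    by move=> /prs; apply: prime_ideal_ideal.
  exists (y * z); first exact: idealMl.
  split=> [|Q1]; first exact: prime_idealMN.
  rewrite inE => /orP[/eqP->|Q1s].
    by apply: idealMr => //; apply: idall; rewrite inE eqxx.
  by apply: idealMl; [apply: idall; rewrite inE Q1s orbT|apply: zs].
exists (x + z); first exact: idealD.
move=> Q1; rewrite inE => /orP[/eqP-> Qxz|Q1s Qxz].
  by apply: Qz; rewrite -[z](addKr x) addrC; apply: idealB.
apply: (xs Q1) => //; rewrite -[x](addrK z).
have [prQ1 _] : prime_ideal Q1 /\ ~ I `<=` Q1 by apply: prs; rewrite inE Q1s orbT.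
by apply: idealB; [apply: prime_ideal_ideal| |apply: zs].
Qed.

End Ideals.

Section LocalRing.
Variables (R : comNzRingType) (M : set R).
Hypothesis locR : local_ring M.

Lemma local_noetherian : noetherian_ring R. Proof. by case: locR. Qed.

Lemma local_ideal : ideal M. Proof. by case: locR => _ [[]]. Qed.

Lemma local_proper : ~ M 1.
Proof. by case: locR => _ [[idM MT] _] _ M1; apply/MT/ideal_one. Qed.

Lemma proper_ideal_local I : ideal I -> ~ I 1 -> I `<=` M.
Proof.
move=> idI I1; case: locR => noethR _ locM.
have [||J maxJ IJ] := @noetherian_maximal_above R
    [set J | ideal J /\ J <> setT] I noethR.
- by move=> J [].
- by split=> // IT; apply: I1; rewrite IT.
by rewrite -(locM J).
Qed.

Lemma local_unit x : ~ M x -> exists y, x * y = 1.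
Proof.
move=> Mx; apply: contrapT => nunit; apply: Mx.
have sub := proper_ideal_local (principal_ideal x).
apply: sub => [[y _ xy1]|]; first by apply: nunit; exists y.
by exists 1; rewrite ?mulr1.
Qed.

Lemma local_not_unit x y : M x -> x * y <> 1.
Proof.
move=> Mx xy1; apply: local_proper; rewrite -xy1.
exact: idealMr local_ideal _ _ Mx.
Qed.

Lemma prime_ideal_local Q : prime_ideal Q -> Q `<=` M.
Proof. by case/prime_idealP=> idQ Q1 _; apply: proper_ideal_local. Qed.

Lemma prime_ideal_sup_local Q : prime_ideal Q -> M `<=` Q -> Q = M.
Proof. by move=> prQ MQ; apply/seteqP; split=> //; apply: prime_ideal_local. Qed.

Lemma local_unit1B m : M m -> ~ M (1 - m).
Proof.
move=> Mm M1m; apply: local_proper; rewrite -[1](subrK m).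
exact: (idealD local_ideal).
Qed.

End LocalRing.

(** * Powers of an ideal and completeness *)

Section IdealPowers.
Variables (R : comNzRingType) (I : set R).

Lemma ideal_powS_mul n x y : I x -> ideal_pow I n y -> ideal_pow I n.+1 (x * y).
Proof. by move=> Ix Iy; apply: ideal_spanS; exists x => //; exists y. Qed.

Lemma ideal_pow_mono m n : (m <= n)%N -> ideal_pow I n `<=` ideal_pow I m.
Proof.
elim: m n => [//|m IHm] [//|n] mn; apply: ideal_span_sub.
  exact: ideal_pow_ideal.
move=> _ [x Ix [y Iy <-]]; apply: ideal_powS_mul => //; exact: IHm Iy.
Qed.

Lemma exp_ideal_pow n x : I x -> ideal_pow I n (x ^+ n).
Proof.
by move=> Ix; elim: n => // n IHn; rewrite exprS; apply: ideal_powS_mul.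
Qed.

Lemma ideal_pow1_sub n : ideal I -> ideal_pow I n.+1 `<=` I.
Proof.
move=> idI; apply: ideal_span_sub => // _ [x Ix [y _ <-]]; exact: idealMr.
Qed.

End IdealPowers.

(** A product with [i + j] factors from [J + xR] has [i] factors from [J] or
    [j] factors equal to [x]. *)
Lemma ideal_pow_add_principal (R : comNzRingType) (I J : set R) x i j : ideal J ->
  (forall y, I y -> exists2 z, J z & exists c, y = z + c * x) ->
  forall y, ideal_pow I (i + j) y ->
    exists2 z, ideal_pow J i z & exists c, y = z + c * x ^+ j.
Proof.
move=> idJ IJ; move: {2}(i + j)%N (erefl (i + j)%N) => n.
elim: n i j => [|n IHn] [|i] [|j] // eqn y.
- by exists y => //; exists 0; rewrite mul0r addr0.
- by move=> _; exists y => //; exists 0; rewrite mul0r addr0.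
- move=> _; exists 0; first exact: ideal0 (ideal_pow_ideal _ _).
  by exists y; rewrite expr0 mulr1 add0r.
have IHi y' : ideal_pow I n y' ->
    exists2 z, ideal_pow J i z & exists c, y' = z + c * x ^+ j.+1.
  by move=> Iy'; apply: IHn => //; move: eqn; rewrite addSn => -[->].
have IHj y' : ideal_pow I n y' ->
    exists2 z, ideal_pow J i.+1 z & exists c, y' = z + c * x ^+ j.
  by move=> Iy'; apply: IHn; move: eqn; rewrite addnS => -[->].
pose K := [set y | exists2 z, ideal_pow J i.+1 z & exists c, y = z + c * x ^+ j.+1].
rewrite eqn; suff: ideal_pow I n.+1 `<=` K by apply.
apply: ideal_span_sub; last first.
  move=> _ [u Iu [v Iv <-]]; have [w Jw [c ->]] := IJ u Iu.
  have [z Jz [d ev]] := IHi v Iv; have [z' Jz' [d' ev']] := IHj v Iv.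
  exists (w * z + c * x * z').
    apply: (idealD (ideal_pow_ideal _ _)); first exact: ideal_powS_mul.
    exact: (idealMl (ideal_pow_ideal _ _)).
  exists (w * d + c * d'); rewrite mulrDl {1}ev ev' exprS.
  by rewrite !mulrDr !mulrDl !mulrA addrACA [c * x * d']mulrAC.
have idJi := ideal_pow_ideal J i.+1.
apply/idealP; split=> [|_ _ [z Jz [c ->]] [w Jw [d ->]]|a _ [z Jz [c ->]]].
- by exists 0; [exact: (ideal0 idJi)|exists 0; rewrite mul0r addr0].
- by exists (z + w); [exact: (idealD idJi Jz Jw)|exists (c + d); rewrite mulrDl addrACA].
- by exists (a * z); [exact: (idealMl idJi _ Jz)|exists (a * c); rewrite mulrDr mulrA].
Qed.

Lemma ideal_span_cons (R : comNzRingType) (x : R) s y :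
  ideal_span [set` x :: s] y ->
  exists2 z, ideal_span [set` s] z & exists c, y = z + c * x.
Proof.
have ids := @ideal_span_ideal R [set` s].
pose K := [set y | exists2 z, ideal_span [set` s] z & exists c, y = z + c * x].
suff: ideal_span [set` x :: s] `<=` K by apply.
apply: ideal_span_sub.
  apply/idealP; split=> [|_ _ [z Jz [c ->]] [w Jw [d ->]]|a _ [z Jz [c ->]]].
  - by exists 0; [exact: (ideal0 ids)|exists 0; rewrite mul0r addr0].
  - by exists (z + w); [exact: (idealD ids Jz Jw)|exists (c + d); rewrite mulrDl addrACA].
  - by exists (a * z); [exact: (idealMl ids _ Jz)|exists (a * c); rewrite mulrDr mulrA].
move=> z; rewrite /= inE => /orP[/eqP->|zs].
  by exists 0; [exact: (ideal0 ids)|exists 1; rewrite mul1r add0r].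
by exists z; [apply: ideal_spanS|exists 0; rewrite mul0r addr0].
Qed.

Lemma ideal_pow_sub_radical (R : comNzRingType) (s : seq R) (E : set R) :
  ideal E -> (forall x, x \in s -> exists n, E (x ^+ n)) ->
  exists N, ideal_pow (ideal_span [set` s]) N `<=` E.
Proof.
move=> idE; elim: s => [|x s IHs] powE.
  exists 1%N => y /(ideal_pow1_sub (ideal_span_ideal _)).
  by apply: ideal_span_sub.
have [y ys|i sE] := IHs; first by apply: powE; rewrite inE ys orbT.
have [|j Ex] := powE x; first by rewrite inE eqxx.
exists (i + j)%N => y.
move=> /(ideal_pow_add_principal (ideal_span_ideal _) (@ideal_span_cons R x s)).
move=> [z /sE Ez [c ->]]; apply: idealD => //; exact: idealMl.
Qed.

(** A weak form of the Artin-Rees lemma: the [I]-adic topology of [aR] is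
    induced from that of [R]. Let [E] be maximal among the ideals meeting [aR]
    exactly in [a I^k]. For [x] in [I], the ideals [(E : x^n)] stabilise, and
    then [E + x^n R] still meets [aR] in [a I^k], because [x^k] carries [aR]
    into [a I^k]; so [x^n] lies in [E]. *)
Lemma artin_rees_principal (R : comNzRingType) (I : set R) (a : R) k :
  noetherian_ring R -> ideal I ->
  exists N, forall b, ideal_pow I N (a * b) ->
    exists2 c, ideal_pow I k c & a * b = a * c.
Proof.
move=> noethR idI; have idIk := ideal_pow_ideal I k.
pose aIk := [set a * c | c in ideal_pow I k].
have idaIk : ideal aIk.
  apply/idealP; split=> [|_ _ [c Ic <-] [d Id <-]|b _ [c Ic <-]].
  - by exists 0; [exact: (ideal0 idIk)|rewrite mulr0].
  - by exists (c + d); [exact: (idealD idIk Ic Id)|rewrite mulrDr].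
  - by exists (b * c); [exact: (idealMl idIk _ Ic)|rewrite mulrCA].
pose C := [set E : set R | [/\ ideal E, aIk `<=` E &
  forall b, E (a * b) -> aIk (a * b)]].
have [|| E [[idE aIkE EaR] Emax]] := @noetherian_maximal R C noethR.
- by move=> E [].
- by exists aIk; split.
have powE x : I x -> exists n, E (x ^+ n).
  move=> Ix; pose D := [set J | exists n, J = [set y | E (x ^+ n * y)]].
  have [|| J [[n ->] Jmax]] := @noetherian_maximal R D noethR.
  - move=> _ [n ->]; apply/idealP; split=> [|y z /= Ey Ez|b y /= Ey] /=.
    + by rewrite mulr0; apply: ideal0.
    + by rewrite mulrDr; apply: idealD.
    + by rewrite mulrCA; apply: idealMl.
  - by exists [set y | E (x ^+ 0 * y)]; exists 0%N.
  have stab i y : E (x ^+ (i + n) * y) -> E (x ^+ n * y).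
    have e : [set y | E (x ^+ (i + n) * y)] = [set y | E (x ^+ n * y)].
      apply: Jmax; first by exists (i + n)%N.
      by move=> z /= Ez; rewrite exprD -mulrA; apply: idealMl.
    by move=> Ey; suff: [set y | E (x ^+ n * y)] y by []; rewrite -e.
  pose E' := [set y | exists2 e, E e & exists c, y = e + x ^+ n * c].
  have EE' : E `<=` E' by move=> e Ee; exists e => //; exists 0; rewrite mulr0 addr0.
  suff <- : E' = E by exists n; exists 0; [exact: ideal0|exists 1; rewrite mulr1 add0r].
  apply: Emax => //; split=> [||b [e Ee [c eab]]].
  - apply/idealP; split=> [|_ _ [z Jz [c ->]] [w Jw [d ->]]|b _ [z Jz [c ->]]].
    + by apply: EE'; apply: ideal0.
    + by exists (z + w); [exact: idealD|exists (c + d); rewrite mulrDr addrACA].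
    + by exists (b * z); [exact: idealMl|exists (b * c); rewrite mulrDr mulrCA].
  - exact: subset_trans aIkE EE'.
  have Ec : E (x ^+ n * c).
    apply: (stab k); rewrite exprD -mulrA.
    have -> : x ^+ n * c = a * b - e by rewrite eab addrC addKr.
    rewrite mulrBr; apply: idealB => //; last exact: idealMl.
    rewrite mulrCA; apply: aIkE; exists (x ^+ k * b) => //.
    by apply: idealMr => //; apply: exp_ideal_pow.
  by apply: EaR; rewrite eab; apply: idealD.
have [s Is] := noethR I idI.
have [|N NE] := @ideal_pow_sub_radical R s E idE.
  by move=> x xs; apply: powE; rewrite Is; apply: ideal_spanS.
exists N => b; rewrite {1}Is => /NE/EaR[c Ic <-].
by exists c.
Qed.

Section Completeness.
Variables (R : comNzRingType) (M : set R).
Hypothesis completeR : adically_complete M.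

Lemma complete_separated x : (forall n, ideal_pow M n x) -> x = 0.
Proof.
move=> Mx; apply: (bij_inj completeR); rewrite rmorph0.
rewrite -(rmorph0 (@completion_class R M)).
apply/completion_classE/asboolP => n; exists 0%N => i _.
rewrite -[X in ideal_pow M n X]/(x - 0) subr0; exact: Mx.
Qed.

Lemma complete_limit (u : nat -> R) : u \in adic_cauchy M ->
  exists x, forall n, exists N, forall i, (N <= i)%N -> ideal_pow M n (u i - x).
Proof.
move=> cu; have [g _ gK] := completeR.
exists (g (completion_class (CauchySeq cu))).
by have /esym/completion_classE/asboolP := gK (completion_class (CauchySeq cu)).
Qed.

Lemma complete_limit_series (u : nat -> R) :
  (forall n, ideal_pow M n (u n.+1 - u n)) ->
  exists x, forall n, ideal_pow M n (u n - x).
Proof.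
move=> Mu; have step n i : (n <= i)%N -> ideal_pow M n (u n - u i).
  move=> /subnK <-; elim: (i - n)%N => [|k IHk].
    by rewrite subrr; apply: ideal0 (ideal_pow_ideal _ _).
  have -> : u n - u (k.+1 + n)%N = (u n - u (k + n)%N) - (u (k + n).+1 - u (k + n)%N).
    by rewrite opprB addrA subrK.
  by apply: ideal_powB => //; apply: ideal_pow_mono (Mu _); rewrite leq_addl.
have cu : u \in adic_cauchy M.
  apply/asboolP => n; exists n => i j ni nj.
  have -> : u i - u j = (u n - u j) - (u n - u i).
    by rewrite opprB [RHS]addrC addrA subrK.
  by apply: ideal_powB; apply: step.
have [x ux] := complete_limit cu; exists x => n; have [N uN] := ux n.
have -> : u n - x = (u n - u (maxn n N)) + (u (maxn n N) - x).
  by rewrite addrA subrK.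
apply: (idealD (ideal_pow_ideal _ _)); first by apply: step; rewrite leq_maxl.
by apply: uN; rewrite leq_maxr.
Qed.

End Completeness.

(** * Roots modulo a prime ideal *)

(** Divide by [X - x] for a root [x]: as the ideal is prime, the other roots are
    roots of the quotient. *)
Lemma poly_roots_mod_prime (R : comNzRingType) (Q : set R) (p : {poly R})
    (rs : seq R) : prime_ideal Q ->
  pairwise [rel x y | ~~ `[< Q (x - y) >]] rs ->
  (forall x, x \in rs -> Q p.[x]) -> (size p <= size rs)%N ->
  forall i, Q p`_i.
Proof.
move=> prQ; have idQ := prime_ideal_ideal prQ.
elim: rs p => [|x rs IHrs] p /=.
  by move=> _ _; rewrite leqn0 size_poly_eq0 => /eqP-> i; rewrite coef0; apply: ideal0.
move=> /andP[/allP xrs distinct] roots szp.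
have Qpx : Q p.[x] by apply: roots; rewrite inE eqxx.
have /factor_theorem[q eq] : root (p - p.[x]%:P) x.
  by rewrite rootE !hornerE subrr.
have ep : p = q * ('X - x%:P) + p.[x]%:P by rewrite -eq subrK.
have szq : (size q <= size rs)%N.
  have [->|q0] := eqVneq q 0%R; first by rewrite size_poly0.
  have szqX : size (q * ('X - x%:P))%R = (size q).+1.
    by rewrite size_Mmonic ?monicXsubC // size_XsubC addn2.
  have : (size (q * ('X - x%:P))%R <= (size rs).+1)%N.
    rewrite -eq (leq_trans (size_polyD _ _)) // geq_max szp size_polyN.
    by rewrite (leq_trans (size_polyC_leq1 _)).
  by rewrite szqX.
have Qq : forall i, Q q`_i.
  apply: IHrs => // y yrs.
  have : Q (q.[y] * (y - x)).
    have -> : q.[y] * (y - x) = p.[y] - p.[x] by rewrite {1}ep !hornerE addrK.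
    by apply: idealB => //; apply: roots; rewrite inE yrs orbT.
  move=> /prime_idealM[] // Qyx; have /asboolP[] := xrs y yrs.
  exact: idealB_sym.
move=> i; rewrite ep coefD coefC mulrBr coefB coefMX coefMC.
apply: idealD => //; last by case: ifP => _ //; apply: ideal0.
apply: idealB => //; last exact: idealMr.
by case: ifP => _; [exact: ideal0|].
Qed.

(** * Counting the elements of a complete local ring *)

Lemma ideal_span_sum (R : comNzRingType) (s : seq R) y :
  ideal_span [set` s] y -> exists f : nat -> R, y = \sum_(j < size s) f j * s`_j.
Proof.
elim: s y => [|x s IHs] y.
  move=> sy; exists (fun=> 0); rewrite big_ord0.
  have id0 : ideal [set (0 : R)].
    by apply/idealP; split=> [|_ _ -> ->|a _ ->] //=; rewrite ?addr0 ?mulr0.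
  by apply: (ideal_span_sub id0 _ sy) => z.
move=> /ideal_span_cons[z /IHs[f ->] [c ->]].
exists (fun j => if j is k.+1 then f k else c).
by rewrite big_ord_recl /= addrC.
Qed.

Section CompleteLocalRing.
Variables (T : comNzRingType) (M : set T).
Hypotheses (locT : local_ring M) (completeT : adically_complete M).

Let idM := local_ideal locT.

Lemma power_series (p : T) : M p -> exists L : (nat -> T) -> T,
  forall c, L c = c 0%N + p * L (fun n => c n.+1).
Proof.
move=> Mp; pose s (c : nat -> T) n := \sum_(i < n) c i * p ^+ i.
have /choice[L LP] : forall c, exists x, forall n, ideal_pow M n (s c n - x).
  move=> c; apply: (complete_limit_series completeT) => n.
  have -> : s c n.+1 - s c n = c n * p ^+ n.
    by rewrite /s big_ord_recr /= addrAC subrr add0r.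
  exact: (idealMl (ideal_pow_ideal _ _)) (exp_ideal_pow _ Mp).
exists L => c; set c' := fun n => c n.+1.
apply/eqP; rewrite -subr_eq0; apply/eqP.
apply: (complete_separated completeT) => n.
have es : s c n.+1 = c 0%N + p * s c' n.
  rewrite /s big_ord_recl expr0 mulr1 mulr_sumr; congr (_ + _).
  by apply: eq_bigr => i _; rewrite exprS mulrCA.
have -> : L c - (c 0%N + p * L c') =
    p * (s c' n - L c') - (s c n.+1 - L c).
  by rewrite es; ring.
apply: ideal_powB; last exact: ideal_pow_mono (LP c n.+1).
by apply: (idealMl (ideal_pow_ideal _ _)).
Qed.

(** Digits of the expansion in powers of [p] are recovered one at a time modulo
    the maximal ideal. *)
Lemma power_series_digits (p : T) (L : (nat -> T) -> T) (Q : set T) c c' :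
  M p -> (forall c, L c = c 0%N + p * L (fun n => c n.+1)) ->
  prime_ideal Q -> ~ Q p ->
  (forall n, M (c n - c' n) -> c n = c' n) ->
  Q (L c - L c') -> forall n, c n = c' n.
Proof.
move=> Mp LE prQ Qp norm QL n.
have head (c1 c2 : nat -> T) : (forall k, M (c1 k - c2 k) -> c1 k = c2 k) ->
    Q (L c1 - L c2) -> c1 0%N = c2 0%N.
  move=> norm12 /(prime_ideal_local locT prQ).
  rewrite LE [L c2]LE opprD addrACA -mulrBr => ML.
  by apply: norm12; apply: (idealDr idM ML); apply: idealMr.
elim: n c c' norm QL => [|n IHn] c c' norm QL; first exact: head.
have c0 : c 0%N = c' 0%N by apply: head.
apply: (IHn (fun n => c n.+1) (fun n => c' n.+1)) => [k|]; first exact: norm.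
move: QL; rewrite LE [L c']LE c0 opprD addrACA subrr add0r -mulrBr.
by move=> /(prime_idealM prQ)[].
Qed.

Let digit (t : T) : T := xget 0 [set s | M (t - s)].

Let digitP t : M (t - digit t).
Proof.
by apply: (@xgetPex _ 0 [set s | M (t - s)]); exists t; rewrite /= subrr; apply: ideal0.
Qed.

Let digit_eq t t' : M (digit t - digit t') -> digit t = digit t'.
Proof.
move=> Mdd; rewrite /digit; congr xget; apply/seteqP.
have Mtt : M (t - t').
  have -> : t - t' = (t - digit t) + (digit t - digit t') - (t' - digit t').
    by rewrite addrA subrK opprB addrA subrK.
  by apply: idealB => //; apply: idealD.
split=> s /= Ms.
- by rewrite -(subrK t t') -addrA; apply: idealD => //; apply: idealB_sym.
- by rewrite -(subrK t' t) -addrA; apply: idealD.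
Qed.

(** An element is determined by its residue, by the residues of the
    coefficients of its non-residual part over generators of the maximal ideal,
    and so on along all words in the generators. *)
Lemma digits_injective : exists d : T -> seq nat -> T,
  (forall t t' w, M (d t w - d t' w) -> d t w = d t' w) /\
  (forall t t', (forall w, d t w = d t' w) -> t = t').
Proof.
have [s Ms] := local_noetherian locT idM.
have /choice[coef coefP] : forall t, exists f : nat -> T,
    t = digit t + \sum_(j < size s) f j * s`_j.
  move=> t; have := digitP t; rewrite {1}Ms => /ideal_span_sum[f fP].
  by exists f; rewrite -fP addrC subrK.
exists (fun t w => digit (foldl coef t w)); split=> [t t' w|t t' dtt'].
  exact: digit_eq.
apply/eqP; rewrite -subr_eq0; apply/eqP.
apply: (complete_separated completeT) => n.
elim: n t t' dtt' => // n IHn t t' dtt'.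
have /= dig := dtt' [::].
rewrite (coefP t) (coefP t') dig opprD addrACA subrr add0r -sumrB.
elim/big_ind: _ => [|x y|j _].
- exact: (ideal0 (ideal_pow_ideal M n.+1)).
- exact: (idealD (ideal_pow_ideal M n.+1)).
rewrite -mulrBl mulrC; apply: ideal_powS_mul.
  by rewrite Ms; apply: ideal_spanS; rewrite /= mem_nth.
by apply: IHn => w; apply: (dtt' (nat_of_ord j :: w)).
Qed.

(** [T] is no larger than [T / Q] for a nonmaximal prime [Q], and the same
    subset of [T] witnesses this for all primes missing [p]. *)
Lemma coset_injection (p : T) : M p -> exists psi : T -> T,
  forall Q, prime_ideal Q -> ~ Q p ->
  forall t t', Q (psi t - psi t') -> t = t'.
Proof.
move=> Mp; have [L LE] := power_series Mp.
have [d [dnorm dinj]] := digits_injective.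
pose c t n := if unpickle n is Some w then d t w else 0.
exists (fun t => L (c t)) => Q prQ Qp t t' QL; apply: dinj => w.
have dig : forall n, c t n = c t' n.
  apply: (power_series_digits Mp LE prQ Qp _ QL) => n.
  rewrite /c; case: unpickle => // w'; exact: dnorm.
by move: (dig (pickle w)); rewrite /c pickleK.
Qed.

Section Uncountable.
Variables (p : T) (Q : set T).
Hypotheses (Mp : M p) (prQ : prime_ideal Q) (Qp : ~ Q p).

Lemma bitstream_injection : exists f : (nat -> bool) -> T,
  forall b b', f b = f b' -> forall n, b n = b' n.
Proof.
have [L LE] := power_series Mp.
exists (fun b => L (fun n => (b n)%:R)) => b b' eL n.
have dig : forall n, (b n)%:R = (b' n)%:R :> T.
  apply: (power_series_digits Mp LE prQ Qp); last first.
    by rewrite eL subrr; apply: ideal0 (prime_ideal_ideal prQ).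
  move=> k; case: (b k) (b' k) => -[] //=; rewrite ?subr0 ?sub0r => M1.
    by case: (local_proper locT).
  by case: (local_proper locT); rewrite -[1]opprK; apply: idealN.
move: (dig n); case: (b n) (b' n) => -[] //= /eqP; rewrite ?oner_eq0 //.
by rewrite eq_sym oner_eq0.
Qed.

Lemma complete_local_uncountable (f : T -> nat) : ~ injective f.
Proof.
move=> finj; have [g ginj] := bitstream_injection.
pose b n := ~~ `[< exists b', f (g b') = n /\ b' n >].
have : b (f (g b)) = ~~ b (f (g b)).
  rewrite {1}/b; congr (~~ _); apply/asboolP/idP.
    by move=> [b' [/finj/ginj <-]].
  by move=> bb; exists b.
by case: (b _).
Qed.

Lemma complete_local_infinite : exists iota : nat -> T, injective iota.
Proof.
have [g ginj] := bitstream_injection.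
exists (fun n => g (fun k => k == n)) => m n /ginj/(_ m).
by rewrite eqxx => /esym/eqP.
Qed.

End Uncountable.
End CompleteLocalRing.

(** * Subrings generated by a family *)

Definition subring (R : comNzRingType) (K : set R) : Prop :=
  [/\ K 1, forall a b, K a -> K b -> K (a - b) &
      forall a b, K a -> K b -> K (a * b)].

Section Subring.
Variables (R : comNzRingType) (K : set R).
Hypothesis ringK : subring K.

Lemma subring1 : K 1. Proof. by case: ringK. Qed.

Lemma subringB a b : K a -> K b -> K (a - b).
Proof. by case: ringK => _ + _; apply. Qed.

Lemma subringM a b : K a -> K b -> K (a * b).
Proof. by case: ringK => _ _; apply. Qed.

Lemma subring0 : K 0.
Proof. by rewrite -(subrr 1); apply: subringB; apply: subring1. Qed.

Lemma subringN a : K a -> K (- a).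
Proof. by rewrite -sub0r; apply: subringB; apply: subring0. Qed.

Lemma subringD a b : K a -> K b -> K (a + b).
Proof. by move=> Ka Kb; rewrite -[b]opprK; apply: subringB => //; apply: subringN. Qed.

Lemma subring_sum I (r : seq I) (P : pred I) (F : I -> R) :
  (forall i, K (F i)) -> K (\sum_(i <- r | P i) F i).
Proof.
by move=> KF; elim/big_ind: _ => //; [exact: subring0|exact: subringD].
Qed.

Lemma subring_adjoin (x : R) :
  subring [set v | exists2 p : {poly R}, (forall i, K p`_i) & v = p.[x]].
Proof.
split=> [|_ _ [p Kp ->] [q Kq ->]|_ _ [p Kp ->] [q Kq ->]].
- exists 1; last by rewrite hornerE.
  by move=> i; rewrite coef1; case: eqP => _; [exact: subring1|exact: subring0].
- exists (p - q); last by rewrite !hornerE.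
  by move=> i; rewrite coefB; apply: subringB.
- exists (p * q); last by rewrite hornerM.
  by move=> i; rewrite coefM; apply: subring_sum => j; apply: subringM.
Qed.

End Subring.

Lemma subring_prime_subring (R : comNzRingType) : subring (@prime_subring R).
Proof.
split=> [|_ _ [a _ <-] [b _ <-]|_ _ [a _ <-] [b _ <-]].
- by exists 1.
- by exists (a - b); rewrite // rmorphB.
- by exists (a * b); rewrite // rmorphM.
Qed.

Section Generated.
Variables (R : comNzRingType) (X : Type) (x : X -> R).

(* Elements of the generated subring are computed by programs in reverse Polish
   notation, whose letters are the generators and three operations. *)
Definition stack_step (st : seq R) (t : nat + X) : seq R :=
  match t, st with
  | inr i, _ => x i :: st
  | inl 0, _ => 1 :: st
  | inl 1, b :: a :: st' => a - b :: st'
  | inl _, b :: a :: st' => a * b :: st'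
  | _, _ => st
  end.

Definition computes (w : seq (nat + X)) (v : R) : Prop :=
  forall st, foldl stack_step st w = v :: st.

Definition generated : set R := [set v | exists w, computes w v].

Lemma generated_subring : subring generated.
Proof.
split=> [|a b [v va] [w wb]|a b [v va] [w wb]].
- by exists [:: inl 0%N].
- by exists (v ++ w ++ [:: inl 1%N]) => st; rewrite !foldl_cat va wb.
- by exists (v ++ w ++ [:: inl 2%N]) => st; rewrite !foldl_cat va wb.
Qed.

Lemma generated_mem i : generated (x i).
Proof. by exists [:: inr i]. Qed.

Lemma generated_sub K : subring K -> (forall i, K (x i)) -> generated `<=` K.
Proof.
move=> ringK Kx v [w wv].
suff Kst : forall st : seq R, (forall y, y \in st -> K y) ->
    forall y, y \in foldl stack_step st w -> K y.
  by apply: (Kst [::]) => //; rewrite wv inE.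
elim: w {v wv} => [//|t w IHw] st Kst /=; apply: IHw => y.
have K2 a b st' : st = b :: a :: st' -> [/\ K a, K b & forall y, y \in st' -> K y].
  move=> est; rewrite est in Kst; split=> [||z zs]; apply: Kst.
  - by rewrite !inE eqxx orbT.
  - by rewrite inE eqxx.
  - by rewrite !inE zs !orbT.
case: t => [[|[|n]]|i] /=; last 1 first.
- by rewrite inE => /orP[/eqP->|/Kst].
- by rewrite inE => /orP[/eqP->|/Kst //]; apply: subring1.
- case: st K2 Kst => [|b [|a st]] K2 Kst; [exact: Kst|exact: Kst|].
  have [Ka Kb Ks] := K2 _ _ _ erefl.
  by rewrite inE => /orP[/eqP->|/Ks //]; apply: subringB.
- case: st K2 Kst => [|b [|a st]] K2 Kst; [exact: Kst|exact: Kst|].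
  have [Ka Kb Ks] := K2 _ _ _ erefl.
  by rewrite inE => /orP[/eqP->|/Ks //]; apply: subringM.
Qed.

End Generated.

Lemma generated_incl (R : comNzRingType) X Y (x : X -> R) (y : Y -> R) :
  (forall i, exists j, x i = y j) -> generated x `<=` generated y.
Proof.
move=> xy; apply: generated_sub; first exact: generated_subring.
by move=> i; have [j ->] := xy i; apply: generated_mem.
Qed.

(** * Small families and transcendental elements *)

Lemma infinite_nat_injection X (A : set X) : ~ finite_set A ->
  exists f : nat -> X, injective f /\ forall n, A (f n).
Proof.
move=> /infiniteP/card_leP[f].
have memT n : n \in [set: nat] by rewrite in_setT.
exists (fun n => val (f (SigSub (memT n)))); split=> [m n|n].
  move=> /val_inj/(@inj _ _ _ f); rewrite !in_setT => /(_ isT isT).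
  by move=> /(congr1 val).
by apply: set_mem; apply: valP.
Qed.

(** Finite sequences, squares and sums do not enlarge an infinite cardinal. The
    triples stand for a prime, a polynomial with coefficients computed by
    programs over [X], and one of its roots. *)
Lemma small_words (T X : Type) : (forall f : T -> nat, ~ injective f) ->
  (forall f : T -> X, ~ injective f) ->
  forall f : T -> nat * seq (seq (nat + X)) * nat, ~ injective f.
Proof.
move=> uncT smallX f finj.
have iota_inj : injective (@inl nat X) by move=> m n [].
have [g ginj] := square_injection iota_inj.
have [h hinj] := seq_injection iota_inj.
pose code (u : nat * seq (seq (nat + X)) * nat) : nat + X :=
  g (g (inl u.1.1, h (map h u.1.2)), inl u.2).
have code_inj : injective code.
  move=> [[m s] n] [[m' s'] n'] /ginj[/ginj[-> /hinj/(inj_map hinj)->] ->].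
  by [].
have [k kinj] : exists k : T -> nat + X, injective k.
  by exists (code \o f); apply: inj_comp.
have [finX|infX] := pselect (finite_set [set: X]).
  have /countable_injP[l linj] := finite_set_countable finX.
  apply: (uncT (fun t => match k t with
    | inl n => pickle (inl n : nat + nat) | inr i => pickle (inr (l i) : nat + nat) end)).
  move=> t t'; move: (@kinj t t').
  case: (k t) (k t') => [m|i] [n|j] kk /(pcan_inj pickleK)// [e]; apply: kk.
    by rewrite e.
  by rewrite (linj i j) ?in_setT.
have [iotaX [iotaX_inj _]] := infinite_nat_injection infX.
have [l linj] := sum_injection iotaX_inj.
by apply: (smallX (l \o k)); apply: inj_comp.
Qed.

Section Transcendental.
Variables (T : comNzRingType) (Qs : seq (set T)) (psi : T -> T).
Hypothesis prQs : forall Q, Q \in Qs -> prime_ideal Q.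
Hypothesis psi_inj : forall Q, Q \in Qs ->
  forall t t', Q (psi t - psi t') -> t = t'.
Hypothesis uncT : forall f : T -> nat, ~ injective f.

(** A relation counts as trivial when its coefficients lie in the prime: over a
    ring meeting the prime in zero, this is transcendence modulo the prime. *)
Definition transcendental X (x : X -> T) (v : T) : Prop :=
  forall Q, Q \in Qs -> forall p : {poly T},
    (forall i, generated x p`_i) -> Q p.[v] -> forall i, Q p`_i.

(** Otherwise every element of [T] would give, through [psi], a root modulo one of
    the primes of a nontrivial polynomial over the generated subring. Each
    polynomial has finitely many roots, and there are too few polynomials. *)
Lemma transcendental_in_coset X (x : X -> T) u f :
  (forall g : T -> X, ~ injective g) -> (forall Q, Q \in Qs -> ~ Q f) ->
  exists t, transcendental x (u + f * t).
Proof.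
move=> smallX Qf; apply: contrapT => /forallNP alg.
have /choice[prog progP] : forall v, exists w, generated x v -> computes x w v.
  move=> v; have [[w wv]|nv] := pselect (generated x v); first by exists w.
  by exists [::].
have prog_inj v v' : generated x v -> generated x v' -> prog v = prog v' -> v = v'.
  move=> /progP/(_ [::]) vP /progP/(_ [::]) v'P e; move: vP.
  by rewrite e v'P => -[].
have /choice[c cP] : forall y, exists c : nat * {poly T},
    [/\ nth set0 Qs c.1 \in Qs, forall i, generated x c.2`_i,
        nth set0 Qs c.1 c.2.[u + f * psi y] &
        exists i, ~ nth set0 Qs c.1 c.2`_i].
  move=> y; have /existsNP[Q /not_implyP[QQs /existsNP[p]]] := alg (psi y).
  move=> /not_implyP[gp /not_implyP[Qp /existsNP[i Qi]]].
  by exists (index Q Qs, p) => /=; rewrite nth_index //; split=> //; exists i.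
pose code y := ((c y).1, map prog (c y).2).
have codeP y y' : code y = code y' -> c y = c y'.
  have [_ gp _ _] := cP y; have [_ gp' _ _] := cP y'.
  rewrite /code; case: (c y) (c y') gp gp' => [k p] [k' p'] /= gp gp' [-> e].
  congr (_, _); apply/polyP => i; apply: prog_inj => //.
  have szp : size p = size p' by move/(congr1 size): e; rewrite !size_map.
  have [ip|ip] := ltnP i (size p).
    by rewrite -!(nth_map 0 [::] prog) ?e -?szp.
  by rewrite !nth_default // -szp.
have fin_fibre y : finite_set [set y' | code y' = code y].
  apply: contrapT => /infinite_nat_injection[g [ginj gy]].
  have [QQs _ _ [i]] := cP y; apply.
  have cg n : c (g n) = c y by apply: codeP; apply: gy.
  have prQ := prQs QQs.
  apply: (@poly_roots_mod_prime _ _ _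
    [seq u + f * psi (g n) | n <- iota 0 (size (c y).2)] prQ).
  - rewrite pairwise_map; apply/(pairwiseP 0%N) => m n /=.
    rewrite !inE size_iota => mp np mn; apply/asboolPn.
    rewrite !nth_iota // !add0n.
    have -> : u + f * psi (g m) - (u + f * psi (g n)) =
      f * (psi (g m) - psi (g n)) by ring.
    apply: prime_idealMN => //; first exact: Qf.
    by move=> /(psi_inj QQs)/ginj e; move: mn; rewrite e ltnn.
  - by move=> z /mapP[n _ ->]; have [_ _ + _] := cP (g n); rewrite cg.
  - by rewrite size_map size_iota.
have /choice[r rP] : forall y, exists r : T -> nat,
    {in [set y' | code y' = code y] &, injective r}.
  by move=> y; apply/countable_injP/finite_set_countable.
have /choice[s sP] : forall k : nat * seq (seq (nat + X)), exists s : T -> nat,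
    {in [set y | code y = k] &, injective s}.
  move=> k; have [[y <-]|nok] := pselect (exists y, code y = k).
    by exists (r y).
  by exists (fun=> 0%N) => y y'; rewrite inE => /= yk; case: nok; exists y.
apply: (small_words uncT smallX (f := fun y => (code y, s (code y) y))).
move=> y y' [e1 e2 e]; have eyy' : code y = code y' by rewrite /code e1 e2.
by apply: (sP (code y')); rewrite ?inE //= -e eyy'.
Qed.

End Transcendental.

(** * Transfinite construction of a dense transcendental subring *)

Lemma well_founded_order (X : eqType) : exists lt : X -> X -> Prop,
  [/\ well_founded lt, forall a b c, lt a b -> lt b c -> lt a c &
      forall a b, [\/ lt a b, a = b | lt b a]].
Proof.
have [R woR] := well_ordering_principle X.
have Rxx a : R a a.
  have [|z [[za zmin] _]] := woR (pred1 a); first by exists a; rewrite inE.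
  have ez : z = a by move: za; rewrite inE => /eqP.
  by rewrite -{1}ez; apply: zmin; rewrite inE.
have Rtot a b : R a b \/ R b a.
  have [|z [[zab zmin] _]] := woR (pred2 a b); first by exists a; rewrite !inE eqxx.
  have := zmin a; have := zmin b; move: zab.
  by rewrite !inE !eqxx orbT => /orP[]/eqP-> /(_ isT) ? /(_ isT) ?; [left|right].
have Ranti a b : R a b -> R b a -> a = b.
  move=> Rab Rba; have [|z [_ zuniq]] := woR (pred2 a b).
    by exists a; rewrite !inE eqxx.
  have <- : z = a.
    apply: zuniq; split=> [|c]; first by rewrite !inE eqxx.
    by rewrite !inE => /orP[]/eqP->.
  apply: zuniq; split=> [|c]; first by rewrite !inE eqxx orbT.
  by rewrite !inE => /orP[]/eqP->.
pose lt a b := R a b /\ a <> b.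
have minlt (A : set X) : A !=set0 -> exists2 z, A z & forall y, A y -> ~ lt y z.
  move=> [a Aa]; have [|z [[zA zmin] _]] := woR [pred y | `[< A y >]].
    by exists a; apply/asboolP.
  exists z; first exact/asboolP.
  move=> y Ay [Ryz]; apply; apply: Ranti => //.
  by apply: zmin; apply/asboolP.
exists lt; split.
- move=> a; apply: contrapT => nacc.
  have [z nz zmin] := minlt [set y | ~ Acc lt y] (ex_intro _ a nacc).
  by apply: nz; constructor=> y yz; apply: contrapT => ny; apply: (zmin y).
- move=> a b c [Rab ab] [Rbc bc].
  have [|z zac zmin] := minlt [set y | [\/ y = a, y = b | y = c]].
    by exists a; constructor 1.
  have za : z = a.
    case: zac => // ez; exfalso.
      by apply: (zmin a); [constructor 1|rewrite ez].
    by apply: (zmin b); [constructor 2|rewrite ez].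
  rewrite za in zmin; split.
    have [//|Rca] := Rtot a c; have [->//|ca] := pselect (c = a).
    by exfalso; apply: (zmin c); [constructor 3|].
  by move=> ac; case: ab; apply: Ranti => //; rewrite ac.
- move=> a b; have [->|ab] := pselect (a = b); first by constructor 2.
  by have [Rab|Rba] := Rtot a b; [constructor 1|constructor 3; split=> // /esym].
Qed.

(** Cut a well-order of [X] at the first initial segment that is as large as
    [X], if there is one. *)
Lemma initial_well_order (X : eqType) : exists (lt : X -> X -> Prop) (I : set X),
  [/\ well_founded lt,
      forall a b, [\/ lt a b, a = b | lt b a],
      forall i j, I i -> lt j i -> I j,
      forall i, I i -> forall g : X -> {j | lt j i}, ~ injective g &
      forall i j k, lt i j -> lt j k -> lt i k] /\
  exists g : X -> {i | I i}, injective g.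
Proof.
have [lt [wf trans tot]] := well_founded_order X; exists lt.
pose big i := exists g : X -> {j | lt j i}, injective g.
have [[i bigi]|nobig] := pselect (exists i, big i); last first.
  exists setT; split.
    split=> // i _ g ginj; apply: nobig; exists i, g; exact: ginj.
  by exists (fun x => exist _ x I) => x y [].
have [i0 [g ginj] imin] : exists2 i0, big i0 & forall j, lt j i0 -> ~ big j.
  elim/(well_founded_ind wf): i bigi => i IH bigi.
  have [[j [ji bigj]]|nobig] := pselect (exists j, lt j i /\ big j).
    exact: IH bigj.
  by exists i => // j ji bigj; apply: nobig; exists j.
exists [set j | lt j i0]; split; last by exists g.
split=> // [k j /= ki0 jk|k /= ki0 h hinj]; first exact: trans ki0.
by apply: (imin k ki0); exists h.
Qed.

Section Dense.
Variables (T : comNzRingType) (Qs : seq (set T)) (psi : T -> T).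
Hypothesis prQs : forall Q, Q \in Qs -> prime_ideal Q.
Hypothesis psi_inj : forall Q, Q \in Qs ->
  forall t t', Q (psi t - psi t') -> t = t'.
Hypothesis uncT : forall f : T -> nat, ~ injective f.
Hypothesis infT : exists iota : nat -> T, injective iota.
Hypothesis Qs_prime_subring : forall Q, Q \in Qs ->
  forall v, prime_subring v -> Q v -> v = 0.

(** Elements [x i] of all the cosets [u + fT] are chosen by transfinite
    recursion, each transcendental modulo every prime over the subring
    generated by the earlier ones. A polynomial in the last index involved
    then shows that the generated subring meets the primes only in zero. *)
Lemma dense_avoiding_subring : exists A : set T, [/\ subring A,
  forall Q, Q \in Qs -> forall v, A v -> Q v -> v = 0 &
  forall u f, (forall Q, Q \in Qs -> ~ Q f) -> exists t, A (u + f * t)].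
Proof.
have [lt [I [[wf tot Iclosed small trans] [g ginj]]]] := initial_well_order T.
have [iota iota_inj] := infT.
have [e einj] := square_injection iota_inj.
(* every pair [(u, f)] is the task of some index *)
pose task (i : T) : T * T := xget (0, 0) [set uf | sval (g (e uf)) = i].
have taskP uf : exists2 i, I i & task i = uf.
  exists (sval (g (e uf))); first exact: svalP.
  rewrite /task; apply: xget_unique => // uf' /eq_sig_hprop e'.
  apply/einj/ginj/e' => ? ? ?; exact: Prop_irrelevance.
pose avoids f := forall Q, Q \in Qs -> ~ Q f.
(* replacing a modulus that lies in one of the primes makes every task solvable *)
pose modulus f : T := if pselect (avoids f) then f else 1.
have modulusP f : avoids (modulus f).
  rewrite /modulus; case: pselect => //= _ Q QQs; apply: prime_ideal1.
  exact: prQs.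
pose good i (y : {j | lt j i} -> T) : set T := [set v | transcendental Qs y v /\
  exists t, v = (task i).1 + modulus (task i).2 * t].
pose x : T -> T := Fix wf (fun _ => T) (fun i rec =>
  xget 0 (@good i (fun j => rec (sval j) (svalP j)))).
pose x_ (S : set T) (j : {j | S j}) : T := x (sval j).
have xE i : x i = xget 0 (@good i (@x_ (lt^~ i))).
  rewrite /x Fix_eq // => {}i rec rec' recE; congr (xget 0 (good _ _)).
  by apply/funext => j; apply: recE.
have xP i : I i -> good i (@x_ (lt^~ i)) (x i).
  move=> Ii; rewrite xE; apply: xgetPex.
  have [t tP] := transcendental_in_coset prQs psi_inj uncT (@x_ (lt^~ i))
    (task i).1 (small i Ii) (modulusP (task i).2).
  by exists ((task i).1 + modulus (task i).2 * t); split=> //; exists t.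
have gen_mono (S S' : set T) : S `<=` S' -> generated (@x_ S) `<=` generated (@x_ S').
  by move=> SS'; apply: generated_incl => -[j Sj]; exists (exist _ j (SS' j Sj)).
(* [K m] is the ring generated by the [x j] with [j] at most [m] *)
pose K m := [set v | exists2 p : {poly T},
  (forall i, generated (@x_ (lt^~ m)) p`_i) & v = p.[x m]].
have ringK m : subring (K m) by apply/subring_adjoin/generated_subring.
have genK m : generated (@x_ (lt^~ m)) `<=` K m.
  move=> v gv; exists v%:P; last by rewrite hornerC.
  move=> i; rewrite coefC; case: eqP => // _.
  exact: subring0 (generated_subring _).
have xK m : K m (x m).
  exists 'X; last by rewrite hornerX.
  have ringG := generated_subring (@x_ (lt^~ m)).
  by move=> i; rewrite coefX; case: eqP => _; [exact: subring1|exact: subring0].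
have K_mono m m' : lt m m' -> K m `<=` K m'.
  move=> mm' v [p gp ->]; apply: genK; rewrite horner_coef.
  have ringG := generated_subring (@x_ (lt^~ m')).
  apply: subring_sum => // i; apply: subringM => //.
    by apply: (gen_mono (lt^~ m)) => // j jm; apply: trans mm'.
  have gx : generated (@x_ (lt^~ m')) (x m).
    exact: (generated_mem (@x_ (lt^~ m')) (exist _ m mm')).
  elim: (nat_of_ord i) => [|n IHn]; first by rewrite expr0; apply: subring1.
  by rewrite exprS; apply: subringM.
have gen_union (S : set T) v : generated (@x_ S) v ->
    prime_subring v \/ exists2 m, S m & K m v.
  have [[m0 Sm0]|noS] := pselect (S !=set0); last first.
    move=> gv; left; move: v gv; apply: generated_sub; first exact: subring_prime_subring.
    by case=> j Sj; case: noS; exists j.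
  suff: generated (@x_ S) `<=` \bigcup_(m in S) K m.
    by move=> sub /sub[m Sm Km]; right; exists m.
  have pair a b : (\bigcup_(m in S) K m) a -> (\bigcup_(m in S) K m) b ->
      exists m, [/\ S m, K m a & K m b].
    move=> [m Sm Ka] [m' Sm' Kb]; case: (tot m m') => [lmm'|e'|lm'm].
    - by exists m'; split=> //; apply: K_mono Ka.
    - by exists m'; split=> //; rewrite -e'.
    - by exists m; split=> //; apply: K_mono Kb.
  apply: generated_sub => [|[j Sj]]; last by exists j.
  split=> [|a b Ua Ub|a b Ua Ub].
  - by exists m0 => //; apply: subring1.
  - by have [m [Sm Ka Kb]] := pair a b Ua Ub; exists m => //; apply: subringB.
  - by have [m [Sm Ka Kb]] := pair a b Ua Ub; exists m => //; apply: subringM.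
pose zero_meet (S : set T) := forall Q, Q \in Qs ->
  forall v, generated (@x_ S) v -> Q v -> v = 0.
have zero_meet_union (S : set T) : S `<=` I ->
    (forall m, S m -> zero_meet (lt^~ m)) -> zero_meet S.
  move=> SI IH Q QQs v /gen_union[pv|[m Sm [p gp ->]]] Qv.
    exact: (Qs_prime_subring QQs).
  have [trm _] := xP m (SI m Sm).
  suff -> : p = 0 by rewrite horner0.
  apply/polyP => i; rewrite coef0; apply: (IH m Sm Q QQs) => //.
  exact: (trm Q QQs p).
have zero_meet_seg i : I i -> zero_meet (lt^~ i).
  elim/(well_founded_ind wf): i => i IH Ii; apply: zero_meet_union => [j /= ji|j ji].
    exact: Iclosed ji.
  by apply: IH => //; apply: Iclosed ji.
exists (generated (@x_ I)); split; first exact: generated_subring.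
  exact: zero_meet_union.
move=> u f Qf; have [i Ii taski] := taskP (u, f).
have [_ [t xi]] := xP i Ii; exists t.
have -> : u + f * t = x i by rewrite xi taski /modulus; case: pselect.
exact: (generated_mem (@x_ I) (exist _ i Ii)).
Qed.

End Dense.

(** * Subrings whose completion is the ambient ring *)

Section SubringType.
Variables (R : comNzRingType) (S : GRing.SubringClosed.type R).

Record subring_of := SubringOf { subring_val :> R; subring_valP : subring_val \in S }.

HB.instance Definition _ := [isSub for subring_val].
HB.instance Definition _ := [Choice of subring_of by <:].
HB.instance Definition _ := [SubChoice_isSubComNzRing of subring_of by <:].

End SubringType.

Lemma subring_subtype (R : comNzRingType) (K : set R) : subring K ->
  exists (S : pred R) (A : GRing.SubComNzRing.type S),
    forall v, K v <-> exists a : A, val a = v.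
Proof.
move=> ringK; pose S : pred R := fun v => `[< K v >].
have closedS : subring_closed S.
  split=> [|a b /asboolP Ka /asboolP Kb|a b /asboolP Ka /asboolP Kb]; apply/asboolP.
  - exact: subring1.
  - exact: subringB.
  - exact: subringM.
pose S' : GRing.SubringClosed.type R :=
  HB.pack S (GRing.isSubringClosed.Build R S closedS).
exists (fun v => v \in S'), (subring_of S') => v; split=> [Kv|[a <-]].
  have Sv : v \in S' by apply/asboolP.
  by exists (SubringOf Sv).
by apply/asboolP; apply: (valP a).
Qed.

(** The two conditions say that the quotients of [A] and [T] by the powers of the
    ideals agree, and the completions are the limits of these quotients. *)
Lemma natural_map_bijective (A T : comNzRingType) (f : {rmorphism A -> T})
    (M : set T) : adically_complete M ->
  (forall n t, exists a, ideal_pow M n (t - f a)) ->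
  (forall n a, ideal_pow M n (f a) -> ideal_pow (f @^-1` M) n a) ->
  bijective (@natural_map A T f M).
Proof.
move=> completeT dense strict.
have nm_inj : injective (@natural_map A T f M).
  elim/completion_classW=> u; elim/completion_classW=> v.
  move=> /(congr1 (to_completion M)); rewrite !(natural_mapE completeT).
  rewrite !completion_mapE => /completion_classE/asboolP nuv.
  apply/completion_classE/asboolP => n; have [N uvN] := nuv n.
  exists N => i Ni; apply: strict.
  rewrite -[(u - v) i]/(u i - v i) rmorphB; exact: uvN.
have nm_surj t : exists x, @natural_map A T f M x = t.
  have /choice[u ut] : forall n, exists a, ideal_pow M n (t - f a).
    by move=> n; apply: dense.
  have cu : u \in adic_cauchy (f @^-1` M).
    apply/asboolP => n; exists n => i j ni nj; apply: strict; rewrite rmorphB.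
    have -> : f (u i) - f (u j) = (t - f (u j)) - (t - f (u i)) by ring.
    apply: ideal_powB; first exact: ideal_pow_mono nj _ (ut j).
    exact: ideal_pow_mono ni _ (ut i).
  exists (completion_class (CauchySeq cu)).
  apply: (bij_inj completeT); rewrite (natural_mapE completeT) completion_mapE.
  apply/completion_classE/asboolP => n; exists n => i ni.
  rewrite -[X in ideal_pow M n X]/(f (u i) - t).
  apply: (idealB_sym (ideal_pow_ideal _ _)); exact: ideal_pow_mono ni _ (ut i).
have /choice[g gK] := nm_surj.
by exists g => // x; apply: nm_inj; rewrite gK.
Qed.

(** [A] inherits its properties from [T] because [A / aA] and [T / aT] coincide
    for every nonzero [a] in [A]: [dense] makes the map between them surjective,
    and [divisible] makes it injective. *)
Section DenseSubring.
Variables (A T : comNzRingType) (f : {rmorphism A -> T}) (M : set T).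
Variable Qs : seq (set T).
Hypotheses (locT : local_ring M) (completeT : adically_complete M).
Hypothesis prQs : forall Q, Q \in Qs -> prime_ideal Q.
Hypothesis Qs_notM : forall Q, Q \in Qs -> ~ M `<=` Q.
Hypothesis Qs_neq0 : exists Q, Q \in Qs.
Hypothesis f_inj : injective f.
Hypothesis zero_meet : forall Q, Q \in Qs -> forall a, Q (f a) -> a = 0.
Hypothesis dense : forall u g, (forall Q, Q \in Qs -> ~ Q g) ->
  exists a t, f a = u + g * t.
Hypothesis divisible : forall a b t, a <> 0 -> f a * t = f b ->
  exists c, f c = t.

Let idM := local_ideal locT.

Lemma dense_decomposition a t : a <> 0 -> exists b t', t = f b + f a * t'.
Proof.
move=> a0; have [b [t' eb]] : exists b t', f b = t + f a * t'.
  by apply: dense => Q QQs Qfa; apply: a0; apply: (zero_meet QQs).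
by exists b, (- t'); rewrite eb mulrN addrK.
Qed.

Lemma dense_integral_domain : GRing.integral_domain_axiom A.
Proof.
move=> a b ab0; have [Q QQs] := Qs_neq0; have prQ := prQs QQs.
have : Q (f a * f b).
  by rewrite -rmorphM ab0 rmorph0; apply: ideal0 (prime_ideal_ideal prQ).
by move=> /(prime_idealM prQ)[]/(zero_meet QQs)->; rewrite eqxx ?orbT.
Qed.

Let domain_exp (a : A) n : a <> 0 -> a ^+ n <> 0.
Proof.
move=> a0; elim: n => [|n IHn]; first by apply/eqP/oner_neq0.
by rewrite exprS => /dense_integral_domain/orP[]/eqP.
Qed.

Let ideal_extension (a : A) (I : set A) : set T :=
  [set t | exists2 b, I b & exists t', t = f b + f a * t'].

Let ideal_extensionP a I : a <> 0 -> ideal I -> ideal (ideal_extension a I).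
Proof.
move=> a0 idI.
apply/idealP; split=> [|_ _ [b Ib [t ->]] [c Ic [u ->]]|r _ [b Ib [t ->]]].
- by exists 0; [exact: ideal0|exists 0; rewrite rmorph0 mulr0 addr0].
- by exists (b + c); [exact: idealD|exists (t + u); rewrite rmorphD mulrDr addrACA].
- have [c [u er]] := dense_decomposition r a0.
  exists (c * b); first exact: idealMl.
  by exists (u * f b + r * t); rewrite {1}er rmorphM er; ring.
Qed.

(** An ideal containing [a] is generated by [a] and by lifts of generators of its
    extension to [T]. *)
Lemma dense_noetherian : noetherian_ring A.
Proof.
move=> I idI; have [[a Ia a0]|I0] := pselect (exists2 a, I a & a <> 0); last first.
  exists [::]; apply/seteqP; split; last by apply: ideal_span_sub.
  move=> a Ia; have [->|a0] := pselect (a = 0); last by case: I0; exists a.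
  exact: ideal0 (ideal_span_ideal _).
have [s Js] := local_noetherian locT (ideal_extensionP a0 idI).
have sJ : [set` s] `<=` ideal_extension a I by rewrite Js; apply: ideal_spanS.
have /choice[beta betaP] : forall t, exists b, ideal_extension a I t ->
    I b /\ exists t', t = f b + f a * t'.
  move=> t; have [[b Ib bt]|nt] := pselect (ideal_extension a I t).
    by exists b.
  by exists 0.
exists (a :: map beta s); set L := ideal_span _.
have idL : ideal L by apply: ideal_span_ideal.
have La : L a by apply: ideal_spanS; rewrite /= inE eqxx.
apply/seteqP; split=> [y Iy|]; last first.
  apply: ideal_span_sub => // y /=; rewrite inE => /orP[/eqP->//|].
  by move=> /mapP[t /sJ/betaP[Ib _] ->].
have [b Lb [t eft]] : ideal_extension a L (f y).
  have : ideal_extension a I (f y) by exists y => //; exists 0; rewrite mulr0 addr0.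
  rewrite Js; apply: ideal_span_sub; first exact: ideal_extensionP.
  move=> t ts; have [_ [t' et]] := betaP t (sJ t ts).
  exists (beta t); last by exists t'.
  by apply: ideal_spanS; rewrite /= inE map_f ?orbT.
have [c ec] : exists c, f c = t.
  apply: (divisible (b := y - b) a0).
  by rewrite rmorphB eft addrAC subrr add0r.
have -> : y = b + c * a by apply: f_inj; rewrite rmorphD rmorphM ec eft mulrC.
by apply: (idealD idL) => //; apply: (idealMl idL).
Qed.

Lemma dense_local : local_ring (f @^-1` M).
Proof.
have idfM : ideal (f @^-1` M).
  apply/idealP; split=> [|a b /= Ma Mb|a b /= Mb] /=.
  - by rewrite rmorph0; apply: ideal0.
  - by rewrite rmorphD; apply: idealD.
  - by rewrite rmorphM; apply: idealMl.
have proper_sub N : ideal N -> N <> setT -> N `<=` f @^-1` M.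
  move=> idN NT b Nb /=; apply: contrapT => Mb; apply: NT.
  have [y fby] := local_unit locT Mb.
  have b0 : b <> 0 by move=> b0; apply: Mb; rewrite b0 rmorph0; apply: ideal0.
  have [c ec] : exists c, f c = y by apply: (divisible (b := 1) b0); rewrite rmorph1.
  apply: ideal_one => //; have <- : b * c = 1.
    by apply: f_inj; rewrite rmorphM ec rmorph1.
  exact: idealMr.
have fMT : f @^-1` M <> setT.
  move=> e; apply: (local_proper locT); have : [set: A] 1 by [].
  by rewrite -e /= rmorph1.
split; first exact: dense_noetherian.
- split=> [|N [idN NT] MN]; first by split.
  by apply/seteqP; split=> //; apply: proper_sub.
- by move=> N [[idN NT] Nmax]; apply/esym/Nmax => //; apply: proper_sub.
Qed.

(** For [p] in [M], all elements of the coset [g + gpT] are products of [g] and a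
    unit, and [A] meets this coset. *)
Lemma dense_meets_principal g : (forall Q, Q \in Qs -> ~ Q g) ->
  exists a, a <> 0 /\ exists t, f a = g * t.
Proof.
move=> Qg; have [Q Q_in] := Qs_neq0.
have [|p Mp Qp] := @prime_avoidance T M Qs idM.
  by move=> Q' Q's; split; [exact: prQs|exact: Qs_notM].
have [|a [t ea]] := @dense g (g * p).
  by move=> Q' Q's; apply: (prime_idealMN (prQs Q's)); [exact: Qg|exact: Qp].
have {}ea : f a = g * (1 - p * - t) by rewrite ea; ring.
exists a; split; last by exists (1 - p * - t).
move=> a0; have prQ := prQs Q_in.
have : Q (g * (1 - p * - t)).
  by rewrite -ea a0 rmorph0; apply: ideal0 (prime_ideal_ideal prQ).
move=> /(prime_idealM prQ)[|/(prime_ideal_local locT prQ)]; first exact: Qg.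
by apply: (local_unit1B locT); apply: idealMr.
Qed.

Let nonzero_nonunit : exists a, a <> 0 /\ M (f a).
Proof.
have [|p Mp Qp] := @prime_avoidance T M Qs idM.
  by move=> Q' Q's; split; [exact: prQs|exact: Qs_notM].
have [a [a0 [t ea]]] := dense_meets_principal Qp.
by exists a; split=> //; rewrite ea; apply: idealMr.
Qed.

Lemma dense_adically n t : exists a, ideal_pow M n (t - f a).
Proof.
have [a [a0 Ma]] := nonzero_nonunit.
have [b [t' et]] := dense_decomposition t (@domain_exp a n a0).
exists b; rewrite et addrC addKr rmorphXn.
by apply: (idealMr (ideal_pow_ideal _ _)); apply: exp_ideal_pow.
Qed.

(** Modulo [c^n], with [c] a nonzero element of the maximal ideal of [A], the
    powers of the two maximal ideals correspond. *)
Lemma dense_strict n a : ideal_pow M n (f a) -> ideal_pow (f @^-1` M) n a.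
Proof.
have [c [c0 Mc]] := nonzero_nonunit; have cn0 := @domain_exp c n c0.
have [->//|n0] := posnP n.
have Mcn t : M (f (c ^+ n) * t).
  apply: idealMr => //; rewrite rmorphXn -(prednK n0) exprS; exact: idealMr.
have MS k : ideal_pow M k `<=` ideal_extension (c ^+ n) (ideal_pow (f @^-1` M) k).
  elim: k => [|k IHk] t.
    move=> _; have [b [t' ->]] := dense_decomposition t cn0.
    by exists b => //; exists t'.
  apply: ideal_span_sub; first exact: ideal_extensionP cn0 (ideal_pow_ideal _ _).
  move=> _ [x Mx [y /IHk[b Mb [u ->]] <-]].
  have [d [v ex]] := dense_decomposition x cn0.
  exists (d * b); last by exists (v * f b + x * u); rewrite {1}ex rmorphM ex; ring.
  apply: ideal_powS_mul => //=.
  by apply: (idealDr idM (y := f (c ^+ n) * v)) => //; rewrite -ex.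
move=> /MS[b Mb [t ea]].
have [d ed] : exists d, f d = t.
  by apply: (divisible (b := a - b) cn0); rewrite rmorphB ea addrAC subrr add0r.
have -> : a = b + d * c ^+ n by apply: f_inj; rewrite rmorphD rmorphM ed ea mulrC.
apply: (idealD (ideal_pow_ideal _ _)) => //.
by apply: (idealMl (ideal_pow_ideal _ _)); apply: exp_ideal_pow.
Qed.

Lemma dense_completion : bijective (@natural_map A T f M).
Proof.
exact: natural_map_bijective completeT dense_adically dense_strict.
Qed.

Lemma dense_generic_formal_fiber : generic_formal_fiber f =
  [set P | prime_ideal P /\ exists2 Q, Q \in Qs & P `<=` Q].
Proof.
apply/seteqP; split=> P [prP]; last first.
  move=> [Q QQs PQ]; split=> //; apply/seteqP; split=> [a /= /PQ|_ ->] /=.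
    exact: zero_meet QQs _.
  by rewrite rmorph0; apply: ideal0 (prime_ideal_ideal prP).
move=> P0; split=> //; apply: contrapT => nPQ.
have idP := prime_ideal_ideal prP.
have [|g Pg Qg] := @prime_avoidance T P Qs idP.
  by move=> Q QQs; split; [exact: prQs|move=> PQ; apply: nPQ; exists Q].
have [a [a0 [t ea]]] := dense_meets_principal Qg.
apply: a0; have : (f @^-1` P) a by rewrite /= ea; apply: idealMr.
by rewrite P0.
Qed.

End DenseSubring.

(** Nonzero elements of [A] are regular in [T]; so a quotient of two of them that
    lies in one of the primes has its numerator there, hence is zero. *)
Lemma division_closure (T : comNzRingType) (Qs : seq (set T)) (A : set T) :
  (forall Q, Q \in Qs -> prime_ideal Q) ->
  (forall a x, a * x = 0 -> x <> 0 -> exists2 Q, Q \in Qs & Q a) ->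
  subring A -> (forall Q, Q \in Qs -> forall v, A v -> Q v -> v = 0) ->
  exists D : set T, [/\ subring D, A `<=` D,
    forall Q, Q \in Qs -> forall v, D v -> Q v -> v = 0 &
    forall a t, D a -> a <> 0 -> D (a * t) -> D t].
Proof.
move=> prQs regular ringA zeroA.
have regA a x : A a -> a <> 0 -> a * x = 0 -> x = 0.
  move=> Aa a0 ax0; apply: contrapT => x0; have [Q QQs Qa] := regular a x ax0 x0.
  exact/a0/(zeroA Q).
have mulA a b : A a -> a <> 0 -> b <> 0 -> a * b <> 0.
  by move=> Aa a0 b0 /(regA _ _ Aa a0).
exists [set t | exists a, [/\ A a, a <> 0 & A (a * t)]]; split.
- split=> [|s t [a [Aa a0 As]] [b [Ab b0 At]]|s t [a [Aa a0 As]] [b [Ab b0 At]]].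
  + by exists 1; rewrite mulr1; split; [exact: subring1| |exact: subring1];
      apply/eqP/oner_neq0.
  + exists (a * b); split; [exact: subringM|exact: (mulA a b)|].
    have -> : a * b * (s - t) = b * (a * s) - a * (b * t) by ring.
    by apply: subringB => //; apply: subringM.
  + exists (a * b); split; [exact: subringM|exact: (mulA a b)|].
    have -> : a * b * (s * t) = (a * s) * (b * t) by ring.
    exact: subringM.
- move=> t At; exists 1; rewrite mul1r; split=> //; first exact: subring1.
  by apply/eqP/oner_neq0.
- move=> Q QQs t [a [Aa a0 Aat]] Qt; apply: (regA a t Aa a0).
  apply: (zeroA Q) => //; apply: idealMl => //.
  exact: prime_ideal_ideal (prQs Q QQs).
- move=> a t [b [Ab b0 Aba]] a0 [c [Ac c0 Acat]].
  exists (b * a * c); split.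
  + exact: subringM.
  + by apply: (mulA (b * a) c) => //; apply: (mulA b a).
  + have -> : b * a * c * t = b * (c * (a * t)) by ring.
    exact: subringM.
Qed.

(** * The formal fibres of a local domain *)

Section Completion.
Variables (A T : comNzRingType) (f : {rmorphism A -> T}) (M : set T).
Hypothesis completeT : adically_complete M.
Hypothesis bij_nm : bijective (@natural_map A T f M).

Local Notation nm := (@natural_map A T f M).

Let natural_map0 : nm (0 : completion (f @^-1` M)) = 0.
Proof. by apply: (bij_inj completeT); rewrite (natural_mapE completeT) !rmorph0. Qed.

Let natural_map_to_completion a : nm (to_completion (f @^-1` M) a) = f a.
Proof.
apply: (bij_inj completeT); rewrite (natural_mapE completeT) completion_mapE.
by congr completion_class; apply: val_inj.
Qed.

Let natural_map_surj t : exists u, nm (completion_class u) = t.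
Proof.
have [g _ gK] := bij_nm; exists (repr (g t)).
by rewrite /completion_class reprK gK.
Qed.

(** By the Artin-Rees lemma, a sequence in a Noetherian domain is null as soon as
    one of its nonzero multiples is. *)
Lemma completion_torsion_free a x : noetherian_ring A -> ideal M ->
  GRing.integral_domain_axiom A -> a <> 0 -> f a * x = 0 -> x = 0.
Proof.
move=> noethA idM domA a0; have [u <-] := natural_map_surj x => ax0.
have idfM : ideal (f @^-1` M).
  apply/idealP; split=> [|b c /= Mb Mc|b c /= Mc] /=.
  - by rewrite rmorph0; apply: ideal0.
  - by rewrite rmorphD; apply: idealD.
  - by rewrite rmorphM; apply: idealMl.
have [nmM1 nmM] := natural_map_is_monoid_morphism f completeT.
have /(bij_inj bij_nm) : nm (to_completion (f @^-1` M) a * completion_class u) =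
    nm (0 : completion (f @^-1` M)).
  by rewrite nmM natural_map_to_completion ax0 natural_map0.
rewrite /to_completion -rmorphM -(rmorph0 (@completion_class _ (f @^-1` M))).
move=> /completion_classE/asboolP null_au.
suff -> : completion_class u = 0 by [].
rewrite -(rmorph0 (@completion_class _ (f @^-1` M))).
apply/completion_classE/asboolP => k.
have [N ar] := artin_rees_principal a k noethA idfM.
have [N' auN] := null_au N; exists N' => i Ni.
have : ideal_pow (f @^-1` M) N (a * u i).
  by rewrite -[a * u i]subr0; apply: auN.
move=> /ar[c Ic auc]; rewrite -[X in ideal_pow _ _ X]/(u i - 0) subr0.
have /domA/orP[/eqP//|] : a * (u i - c) = 0 by rewrite mulrBr auc subrr.
by rewrite subr_eq0 => /eqP->.
Qed.

(** When the maximal ideal of [A] is zero, Cauchy sequences are eventually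
    constant. *)
Lemma completion_discrete : f @^-1` M = [set 0] -> forall t, exists a, f a = t.
Proof.
move=> fM0 t; have [u <-] := natural_map_surj t.
have /asboolP/(_ 1%N)[N uN] := valP u.
exists (u N); rewrite -natural_map_to_completion; congr nm.
apply/completion_classE/asboolP => n; exists N => i Ni.
have e : (f @^-1` M) (u N - u i).
  apply: (@ideal_pow1_sub _ _ 0); last exact: uN.
  by rewrite fM0; apply/idealP; split=> [|_ _ -> ->|b _ ->] //=; rewrite ?addr0 ?mulr0.
have {}e : u N - u i = 0 by move: (u N - u i) e => d; rewrite fM0.
rewrite -[X in ideal_pow _ _ X]/(u N - u i) e.
exact: ideal0 (ideal_pow_ideal _ _).
Qed.

End Completion.

Lemma field_local_ring (R : comNzRingType) : is_field R -> local_ring [set (0 : R)].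
Proof.
move=> fieldR.
have id0 : ideal [set (0 : R)].
  by apply/idealP; split=> [|_ _ -> ->|a _ ->] //=; rewrite ?addr0 ?mulr0.
have ideal_field (I : set R) : ideal I -> I <> setT -> I = [set 0].
  move=> idI IT; apply/seteqP; split=> [x Ix|_ ->]; last exact: ideal0.
  apply: contrapT => /= /eqP x0; apply: IT; apply: ideal_one => //.
  by have [y <-] := fieldR x x0; apply: idealMr.
have n0T : [set 0] <> [set: R].
  move=> e; have /eqP : [set (0 : R)] 1 by rewrite e.
  by rewrite oner_eq0.
split.
- move=> I idI; have [->|IT] := pselect (I = setT).
    exists [:: 1]; apply/esym/ideal_one; first exact: ideal_span_ideal.
    by apply: ideal_spanS; rewrite /= inE.
  exists [::]; rewrite (ideal_field I idI IT); apply/seteqP; split.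
    by move=> _ ->; apply: ideal0 (ideal_span_ideal _).
  exact: ideal_span_sub.
- split=> // Q [idQ QT] _; exact: ideal_field.
- by move=> N [[idN NT] _]; apply: ideal_field.
Qed.

(** When [M] lies in the fibre, [A] is a field and hence complete. Otherwise an
    associated prime [P], the annihilator of [x], lies in the fibre because an
    element of [A] in [P] kills [x] and [T] is torsion-free over [A]. *)
Lemma fiber_conditions (A T : comNzRingType) (f : {rmorphism A -> T}) (M : set T)
    (G : set (set T)) :
  local_ring M -> adically_complete M -> G !=set0 ->
  local_ring (f @^-1` M) -> GRing.integral_domain_axiom A ->
  bijective (@natural_map A T f M) -> generic_formal_fiber f = G ->
  (is_field T /\ G = [set [set 0]]) \/
  [/\ ~ G M /\ @associated_prime T `<=` G,
      forall Q P : set T, G Q -> prime_ideal P -> P `<=` Q -> G P &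
      forall Q : set T, G Q -> Q `&` @prime_subring T = [set 0]].
Proof.
move=> locT completeT G_neq0 locA domA bij_nm fiberG.
have GE Q : G Q <-> prime_ideal Q /\ f @^-1` Q = [set 0] by rewrite -fiberG.
have [GM|nGM] := pselect (G M); [left|right].
  have [_ fM0] := (GE M).1 GM.
  have f_surj := completion_discrete completeT bij_nm fM0.
  split.
    move=> x x0; have [a fa] := f_surj x.
    have a0 : a <> 0 by move=> a0; move: x0; rewrite -fa a0 rmorph0 eqxx.
    have [|y ay1] := local_unit locA (x := a); first by rewrite fM0.
    by exists (f y); rewrite -fa -rmorphM ay1 rmorph1.
  have G0 Q : G Q -> Q = [set 0].
    move=> /GE[/prime_ideal_ideal idQ fQ0].
    apply/seteqP; split=> [t|_ ->]; last exact: ideal0.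
    have [a <-] := f_surj t => Qa; have : (f @^-1` Q) a by [].
    by rewrite fQ0 /= => ->; rewrite rmorph0.
  apply/seteqP; split=> Q; first exact: G0.
  by have [Q' GQ'] := G_neq0; rewrite -(G0 Q' GQ') => ->.
split.
- split=> // P [prP [x eP]]; apply/GE; split=> //.
  have idP := prime_ideal_ideal prP.
  apply/seteqP; split=> [a /=|_ ->] /=; last by rewrite rmorph0; apply: ideal0.
  rewrite eP => ax0; apply: contrapT => a0.
  have x0 := completion_torsion_free completeT bij_nm (local_noetherian locA)
    (local_ideal locT) domA a0 ax0.
  by apply: (prime_ideal1 prP); rewrite eP /annihilator /= mul1r.
- move=> Q P /GE[prQ fQ0] prP PQ; apply/GE; split=> //.
  apply/seteqP; split=> [a Pa|_ ->] /=.
    by rewrite -[a = 0]/([set 0] a) -fQ0; apply: PQ.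
  by rewrite rmorph0; apply: ideal0; apply: prime_ideal_ideal.
- move=> Q /GE[prQ fQ0]; have idQ := prime_ideal_ideal prQ.
  apply/seteqP; split=> [v [Qv [z _ ezv]]|_ ->] /=; last first.
    by split; [exact: ideal0|exists 0].
  have : (f @^-1` Q) z%:~R by rewrite /= rmorph_int ezv.
  by rewrite fQ0 => /= z0; rewrite -ezv -(rmorph_int f) z0 rmorph0.
Qed.

Lemma field_fiber (T : comNzRingType) (M : set T) (G : set (set T)) :
  local_ring M -> adically_complete M -> G `<=` @prime_ideal T ->
  is_field T -> G = [set [set 0]] ->
  exists (S : pred T) (A : GRing.SubComNzRing.type S),
    let incl : {rmorphism A -> T} := val in
    [/\ local_ring (incl @^-1` M), GRing.integral_domain_axiom A,
        bijective (@natural_map A T incl M) & generic_formal_fiber incl = G].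
Proof.
move=> locT completeT G_spec fieldT G0.
have [|S [A valE]] := @subring_subtype T setT; first by split.
exists S, A; set f : {rmorphism A -> T} := val; cbv zeta.
have f_inj : injective f by apply: val_inj.
have f_surj t : exists a, f a = t by apply/valE.
have M0 x : M x -> x = 0.
  move=> Mx; apply: contrapT => /eqP x0; have [y] := fieldT x x0.
  exact: (local_not_unit locT).
have fM0 : f @^-1` M = [set 0].
  apply/seteqP; split=> [a /= /M0|_ ->] /=.
    by rewrite -(rmorph0 f) => /f_inj.
  by rewrite rmorph0; apply: ideal0; apply: local_ideal locT.
have fieldA : is_field A.
  move=> a a0; have [|y fay1] := fieldT (f a).
    by apply: contra_neq a0; rewrite -[X in _ = X -> _](rmorph0 f) => /f_inj.
  have [b fb] := f_surj y; exists b; apply: f_inj.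
  by rewrite rmorphM fb fay1 rmorph1.
split.
- by rewrite fM0; apply: field_local_ring.
- move=> a b ab0; have [//|a0] := boolP (a == 0).
  have [c ac1] := fieldA a a0; apply/eqP.
  by rewrite -[b]mul1r -ac1 mulrAC ab0 mul0r.
- apply: natural_map_bijective => // [n t|[//|n] a].
    have [a <-] := f_surj t; exists a; rewrite subrr.
    exact: ideal0 (ideal_pow_ideal _ _).
  move=> /(ideal_pow1_sub (local_ideal locT))/M0.
  rewrite -(rmorph0 f) => /f_inj->; exact: ideal0 (ideal_pow_ideal _ _).
rewrite G0; apply/seteqP; split=> [P [prP fP0]|_ ->].
  apply/seteqP; split=> [t|_ ->]; last exact: ideal0 (prime_ideal_ideal prP).
  have [a <-] := f_surj t => Pa; have : (f @^-1` P) a by [].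
  by rewrite fP0 /= => ->; rewrite rmorph0.
split; first by apply: G_spec; rewrite G0.
apply/seteqP; split=> [a /=|_ ->] /=; last exact: rmorph0.
by rewrite -[X in _ = X -> _](rmorph0 f) => /f_inj.
Qed.

(** The ring is the division closure of a dense subring avoiding the finitely many
    maximal elements of [G]. *)
Lemma semilocal_fiber (T : comNzRingType) (M : set T) (G : set (set T)) :
  local_ring M -> adically_complete M -> G `<=` @prime_ideal T -> G !=set0 ->
  finite_set (maximal_elements G) -> ~ G M -> @associated_prime T `<=` G ->
  (forall Q P : set T, G Q -> prime_ideal P -> P `<=` Q -> G P) ->
  (forall Q : set T, G Q -> Q `&` @prime_subring T = [set 0]) ->
  exists (S : pred T) (A : GRing.SubComNzRing.type S),
    let incl : {rmorphism A -> T} := val in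
    [/\ local_ring (incl @^-1` M), GRing.integral_domain_axiom A,
        bijective (@natural_map A T incl M) & generic_formal_fiber incl = G].
Proof.
move=> locT completeT G_spec [Q0 GQ0] /finite_seqP[Qs maxG] nGM assG downG intG.
have noethT := local_noetherian locT.
have above Q : G Q -> exists2 Q', Q' \in Qs & Q `<=` Q'.
  move=> GQ; have [||Q' maxQ' QQ'] := @noetherian_maximal_above T G Q noethT.
  - by move=> P /G_spec/prime_ideal_ideal.
  - by [].
  by exists Q' => //; move: maxQ'; rewrite maxG.
have QsG Q : Q \in Qs -> G Q.
  by move=> QQs; have : [set` Qs] Q by []; rewrite -maxG => -[].
have prQs Q : Q \in Qs -> prime_ideal Q by move=> /QsG/G_spec.
have Qs_notM Q : Q \in Qs -> ~ M `<=` Q.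
  move=> QQs MQ; apply: nGM; rewrite -(prime_ideal_sup_local locT (prQs Q QQs) MQ).
  exact: QsG.
have [Q1 Q1Qs _] := above Q0 GQ0.
have regular (a x : T) : a * x = 0 -> x <> 0 -> exists2 Q, Q \in Qs & Q a.
  move=> ax0 x0; have [P /assG/above[Q QQs PQ] Pa] :=
    zero_divisor_associated noethT ax0 x0.
  by exists Q => //; apply: PQ.
have [|p Mp Qp] := @prime_avoidance T M Qs (local_ideal locT).
  by move=> Q QQs; split; [exact: prQs|exact: Qs_notM].
have [psi psiP] := coset_injection locT completeT Mp.
have [||||R [ringR zeroR denseR]] := @dense_avoiding_subring T Qs psi prQs.
- by move=> Q QQs; apply: psiP; [exact: prQs|exact: Qp].
- exact: (complete_local_uncountable locT completeT Mp (prQs Q1 Q1Qs) (Qp Q1 Q1Qs)).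
- exact: (complete_local_infinite locT completeT Mp (prQs Q1 Q1Qs) (Qp Q1 Q1Qs)).
- move=> Q QQs v pv Qv; suff: (Q `&` @prime_subring T) v by rewrite intG //; apply: QsG.
  by split.
have [D [ringD RD zeroD divD]] := division_closure prQs regular ringR zeroR.
have [S [A valE]] := subring_subtype ringD.
exists S, A; set f : {rmorphism A -> T} := val; cbv zeta.
have f_inj : injective f by apply: val_inj.
have Df a : D (f a) by apply/valE; exists a.
have f0 a : f a = 0 -> a = 0 by rewrite -(rmorph0 f) => /f_inj.
have zero_meet Q : Q \in Qs -> forall a, Q (f a) -> a = 0.
  by move=> QQs a Qa; apply: f0; apply: zeroD QQs _ _ _.
have dense u g : (forall Q, Q \in Qs -> ~ Q g) -> exists a t, f a = u + g * t.
  move=> Qg; have [t Rt] := denseR u g Qg.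
  by have /valE[a fa] := RD _ Rt; exists a, t.
have divisible a b t : a <> 0 -> f a * t = f b -> exists c, f c = t.
  move=> a0 e; apply/valE; apply: (divD (f a)) => //; last by rewrite e.
  by move=> /f0.
have neq0 : exists Q, Q \in Qs by exists Q1.
split.
- exact: (dense_local locT f_inj zero_meet dense divisible).
- exact: (dense_integral_domain prQs neq0 zero_meet).
- exact: (dense_completion locT completeT prQs Qs_notM neq0 f_inj zero_meet dense
    divisible).
rewrite (dense_generic_formal_fiber locT prQs Qs_notM neq0 zero_meet dense).
apply/seteqP; split=> [P [prP [Q QQs PQ]]|P GP].
  exact: downG (QsG Q QQs) prP PQ.
by split; [exact: G_spec|exact: above].
Qed.

Theorem theorem3p1 (T : comNzRingType) (M : set T) (G : set (set T))
    (locT : local_ring M) (completeT : adically_complete M)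
    (G_spec : G `<=` @prime_ideal T) (G_neq0 : G !=set0)
    (G_max_fin : finite_set (maximal_elements G)) :
  (exists (S : pred T) (A : GRing.SubComNzRing.type S),
    let incl : {rmorphism A -> T} := val in
    [/\ local_ring (incl @^-1` M), GRing.integral_domain_axiom A,
        bijective (@natural_map A T incl M) &
        generic_formal_fiber incl = G])
  <->
  (is_field T /\ G = [set [set 0]]) \/
  [/\ ~ G M /\ @associated_prime T `<=` G,
      forall Q P : set T, G Q -> prime_ideal P -> P `<=` Q -> G P &
      forall Q : set T, G Q -> Q `&` @prime_subring T = [set 0]].
Proof.
split=> [[S [A [locA domA bij_nm fiberG]]]|[[fieldT G0]|[[nGM assG] downG intG]]].
- exact: fiber_conditions locT completeT G_neq0 locA domA bij_nm fiberG.
- exact: field_fiber.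
- exact: semilocal_fiber.
Qed.
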